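(* Let $R$ be a one dimensional generically Gorenstein Cohen-Macaulay local ring with canonical ideal $\omega$. Assume that $\mathrm{can.red}(R)\le 2$. Then the following are equivalent for $M\in\Omega\mathrm{CM}(R)$: (1) The canonical dual $DM=\mathrm{Hom}_R(M,\omega)$ belongs to $\Omega\mathrm{CM}(R)$. (2) There is an inclusion $\mathrm{tr}(M)\subseteq\mathrm{tr}(\omega)$.
   Context: All rings are commutative Noetherian local and all modules are finitely generated. $\mathrm{CM}(R)$ is the category of maximal Cohen-Macaulay $R$-modules. A syzygy of a module $M$ is the kernel of a surjection $P\to M$ with $P$ (finitely generated) projective; $\Omega\mathrm{CM}(R)$ is the category of modules that are syzygies of maximal Cohen-Macaulay modules. A Cohen-Macaulay local ring $R$ is generically Gorenstein if $R_p$ is Gorenstein for every minimal prime $p$; a canonical ideal is an ideal of $R$ isomorphic to a canonical module of $R$. The trace ideal $\mathrm{tr}(M)$ is the ideal of $R$ generated by all $f(m)$ with $f\in M^*=\mathrm{Hom}_R(M,R)$ and $m\in M$. Canonical reduction number: $\mathrm{can.red}(R)$ is the infimum of all nonnegative integers $n$ such that there exist a canonical ideal $\omega$ of $R$ and an almost reduction $(a)$ of $\omega$ with $\omega^{n+1}=a\omega^n$. Here $(a)$, $a\in R$, being an almost reduction of $\omega$ means that $\omega^{m+1}=a\omega^m$ for some $m\ge 0$, where $a$ is not required to lie in $\omega$. *)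

(* Defs.v *)
From HB Require Import structures.
From mathcomp Require Import all_boot all_order all_algebra.
From mathcomp Require Import all_classical.

Set Implicit Arguments.
Unset Strict Implicit.
Unset Printing Implicit Defensive.

Import GRing.Theory.

Local Open Scope classical_set_scope.
Local Open Scope ring_scope.

(** * Submodules and modules of homomorphisms *)

Section Submodules.
Variables (R : pzRingType) (V : lmodType R).

Definition is_submodule (A : set V) : Prop := submod_closed [in A].

Definition submod_span (A : set V) : set V := smallest is_submodule A.

Definition fin_gen : Prop := exists s : seq V, submod_span [set` s] = setT.

End Submodules.

Arguments fin_gen {R} V.

(* A submodule, given as a membership predicate, as a module in its own
   right. *)
Record submodule_type (R : pzRingType) (V : lmodType R) (S : submodClosed V) :=
  SubmoduleType { submodule_val :> V; _ : submodule_val \in S }.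

Section SubmoduleType.
Variables (R : pzRingType) (V : lmodType R) (S : submodClosed V).

HB.instance Definition _ := [isSub for @submodule_val R V S].
HB.instance Definition _ := [Choice of submodule_type S by <:].
HB.instance Definition _ := [SubChoice_isSubLmodule of submodule_type S by <:].

End SubmoduleType.

Definition LinHom (R : comNzRingType) (M N : lmodType R) := {linear M -> N}.

Section HomModule.
Variables (R : comNzRingType) (M N : lmodType R).
Implicit Types f g h : LinHom M N.

Lemma LinHom_eq f g : f =1 g -> f = g.
Proof.
case: f g => [f [[f1] [f2]]] [g [[g1] [g2]]] /= /funext fg.
move: f1 f2 g1 g2; rewrite fg => f1 f2 g1 g2.
by rewrite (Prop_irrelevance f1 g1) (Prop_irrelevance f2 g2).
Qed.

HB.instance Definition _ := gen_eqMixin (LinHom M N).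
HB.instance Definition _ := gen_choiceMixin (LinHom M N).

Definition LinHom0 : LinHom M N := \0.
Definition LinHomN f : LinHom M N := \- f.
Definition LinHomD f g : LinHom M N := f \+ g.

Definition scale_hom (a : R) f (x : M) : N := a *: f x.

Lemma scale_hom_is_linear (a : R) f : linear (scale_hom a f).
Proof.
by move=> b x y; rewrite /scale_hom linearP scalerDr !scalerA mulrC.
Qed.

HB.instance Definition _ (a : R) f :=
  GRing.isLinear.Build R M N _ (scale_hom a f) (scale_hom_is_linear a f).

Definition LinHomZ (a : R) f : LinHom M N := scale_hom a f.

Lemma LinHomDA : associative LinHomD.
Proof. by move=> f g h; apply: LinHom_eq => x /=; rewrite addrA. Qed.

Lemma LinHomDC : commutative LinHomD.
Proof. by move=> f g; apply: LinHom_eq => x /=; rewrite addrC. Qed.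

Lemma LinHomD0 : left_id LinHom0 LinHomD.
Proof. by move=> f; apply: LinHom_eq => x /=; rewrite add0r. Qed.

Lemma LinHomDN : left_inverse LinHom0 LinHomN LinHomD.
Proof. by move=> f; apply: LinHom_eq => x /=; rewrite addNr. Qed.

HB.instance Definition _ :=
  GRing.isZmodule.Build (LinHom M N) LinHomDA LinHomDC LinHomD0 LinHomDN.

Lemma LinHomZA (a b : R) f : LinHomZ a (LinHomZ b f) = LinHomZ (a * b) f.
Proof.
by apply: LinHom_eq => x /=; rewrite /scale_hom /= /scale_hom scalerA.
Qed.

Lemma LinHomZ1 : left_id 1 LinHomZ.
Proof. by move=> f; apply: LinHom_eq => x /=; rewrite /scale_hom scale1r. Qed.

Lemma LinHomZDr : right_distributive LinHomZ +%R.
Proof.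
by move=> a f g; apply: LinHom_eq => x /=; rewrite /scale_hom scalerDr.
Qed.

Lemma LinHomZDl f : {morph LinHomZ^~ f : a b / a + b}.
Proof.
by move=> a b; apply: LinHom_eq => x /=; rewrite /scale_hom scalerDl.
Qed.

HB.instance Definition _ :=
  GRing.Zmodule_isLmodule.Build R (LinHom M N)
    LinHomZA LinHomZ1 LinHomZDr LinHomZDl.

End HomModule.

(** * Exact sequences, resolutions and Ext *)

Section Homological.
Variable R : comNzRingType.
Implicit Types M N E K : lmodType R.

Definition lin_iso M N : Prop := exists f : {linear M -> N}, bijective f.

Definition lin_ker M N (f : {linear M -> N}) : set M := [set x | f x = 0].

Definition exact_at L M N (f : {linear L -> M}) (g : {linear M -> N}) : Prop :=
  range f = lin_ker g.

Definition projective_module (P : lmodType R) : Prop :=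
  forall M N (g : {linear M -> N}) (f : {linear P -> N}),
    range g = setT -> exists h : {linear P -> M}, g \o h =1 f.

Definition injective_module (I : lmodType R) : Prop :=
  forall M N (g : {linear M -> N}) (f : {linear M -> I}),
    injective g -> exists h : {linear N -> I}, h \o g =1 f.

Definition projective_resolution N (P : nat -> lmodType R)
    (d : forall i, {linear P i.+1 -> P i}) (e : {linear P 0%N -> N}) : Prop :=
  [/\ forall i, projective_module (P i),
      range e = setT,
      exact_at (d 0%N) e &
      forall i, exact_at (d i.+1) (d i)].

Definition injective_resolution M (I : nat -> lmodType R)
    (e : {linear M -> I 0%N}) (d : forall i, {linear I i -> I i.+1}) : Prop :=
  [/\ forall i, injective_module (I i),
      injective e,
      exact_at e (d 0%N) &
      forall i, exact_at (d i) (d i.+1)].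

Definition zero_module M : Prop := forall x : M, x = 0.

Definition finite_injdim M : Prop :=
  exists (I : nat -> lmodType R) (e : {linear M -> I 0%N})
         (d : forall i, {linear I i -> I i.+1}) (n : nat),
    injective_resolution e d /\ (forall i, (n < i)%N -> zero_module (I i)).

(* E is isomorphic to Z / B, for submodules B of Z of V. *)
Definition is_subquotient (V : lmodType R) (Z B : set V) E : Prop :=
  exists q : V -> E,
    [/\ forall a u v, Z u -> Z v -> q (a *: u + v) = a *: q u + q v,
        q @` Z = setT &
        Z `&` [set z | q z = 0] = B].

Definition cocycles (P : nat -> lmodType R)
    (d : forall i, {linear P i.+1 -> P i}) M (n : nat) : set (LinHom (P n) M) :=
  [set f | forall x, f (d n x) = 0].

Definition coboundaries (P : nat -> lmodType R)
    (d : forall i, {linear P i.+1 -> P i}) M (n : nat) : set (LinHom (P n) M) :=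
  match n with
  | 0 => [set 0]
  | m.+1 => [set f | exists g : LinHom (P m) M, forall x, f x = g (d m x)]
  end.

(* E is isomorphic to Ext^n(N, M), computed as the n-th cohomology of
   Hom(P, M) for a projective resolution P of N. *)
Definition is_Ext (n : nat) N M E : Prop :=
  exists (P : nat -> lmodType R) (d : forall i, {linear P i.+1 -> P i})
         (e : {linear P 0%N -> N}),
    projective_resolution d e /\
    is_subquotient (cocycles d (M := M) (n := n)) (coboundaries d (n := n)) E.

End Homological.

(** * Ideals and local rings *)

Section Ideals.
Variable R : comNzRingType.
Implicit Types (I J p m : set R) (a : R).

Definition is_ideal I : Prop := is_submodule (I : set R^o).

Definition ideal_mul I J : set R :=
  submod_span ([set x * y | x in I & y in J] : set R^o).

Fixpoint ideal_pow I (n : nat) : set R :=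
  if n is n'.+1 then ideal_mul I (ideal_pow I n') else setT.

Definition ideal_scale a I : set R := [set a * x | x in I].

Definition prime_ideal p : Prop :=
  [/\ is_ideal p, ~ p 1 & forall x y, p (x * y) -> p x \/ p y].

Definition minimal_prime p : Prop :=
  prime_ideal p /\ (forall q, prime_ideal q -> q `<=` p -> q = p).

Definition maximal_ideal m : Prop :=
  [/\ is_ideal m, m <> setT &
      forall I, is_ideal I -> m `<=` I -> I = m \/ I = setT].

End Ideals.

Section Rings.
Variable R : comNzRingType.

Definition noetherian : Prop :=
  forall I : set R, is_ideal I ->
    exists s : seq R^o, submod_span [set` s] = (I : set R^o).

Definition local_ring : Prop := exists! m : set R, maximal_ideal m.

(* The maximal ideal, when R is local. *)
Definition max_ideal : set R := \bigcap_(m in @maximal_ideal R) m.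

Definition prime_chain (n : nat) : Prop :=
  exists p : nat -> set R,
    (forall i, (i <= n)%N -> prime_ideal (p i)) /\
    (forall i, (i < n)%N -> p i `<` p i.+1).

Definition has_krull_dim (d : nat) : Prop :=
  prime_chain d /\ (forall n, prime_chain n -> (n <= d)%N).

End Rings.

Arguments noetherian R : clear implicits.
Arguments local_ring R : clear implicits.
Arguments max_ideal R : clear implicits.
Arguments has_krull_dim R d : clear implicits.

(** * Cohen-Macaulay and Gorenstein rings, canonical modules *)

Section CohenMacaulay.
Variable R : comNzRingType.
Implicit Types M W K C P : lmodType R.

Definition seq_mul (xs : seq R) M : set M :=
  submod_span [set x *: y | x in [set` xs] & y in [set: M]].

Arguments seq_mul xs M : clear implicits.

Definition regular_seq M (xs : seq R) : Prop :=
  [/\ forall x, x \in xs -> max_ideal R x,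
      forall i, (i < size xs)%N -> forall y : M,
        seq_mul (take i xs) M (nth 0 xs i *: y) -> seq_mul (take i xs) M y &
      seq_mul xs M <> [set: M]].

Definition has_depth M (t : nat) : Prop :=
  (exists2 xs, regular_seq M xs & size xs = t) /\
  (forall xs, regular_seq M xs -> (size xs <= t)%N).

Definition cohen_macaulay : Prop :=
  exists2 d, has_krull_dim R d & has_depth R^o d.

(* The zero module is maximal Cohen-Macaulay: its depth is infinite. *)
Definition max_cohen_macaulay M : Prop :=
  fin_gen M /\
  (zero_module M \/ exists2 d, has_krull_dim R d & has_depth M d).

Definition residue_field K : Prop :=
  is_subquotient [set: R^o] (max_ideal R : set R^o) K.

(* A maximal Cohen-Macaulay module of finite injective dimension and of type 1,
   that is, Ext^d(k, W) is isomorphic to k, where d is the dimension of R and k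
   its residue field. *)
Definition canonical_module W : Prop :=
  exists (d : nat) (k : lmodType R),
    [/\ has_krull_dim R d, residue_field k, max_cohen_macaulay W,
        finite_injdim W & is_Ext d k W k].

Definition gorenstein : Prop :=
  [/\ noetherian R, local_ring R & finite_injdim R^o].

(* The class of syzygies of maximal Cohen-Macaulay modules, closed under
   isomorphism. *)
Definition OmegaCM M : Prop :=
  exists (P C : lmodType R) (f : {linear M -> P}) (g : {linear P -> C}),
    [/\ fin_gen P, projective_module P, max_cohen_macaulay C &
        [/\ injective f, exact_at f g & range g = setT]].

Definition trace_ideal M : set R :=
  submod_span [set y : R^o | exists (f : {linear M -> R^o}) (x : M), y = f x].

End CohenMacaulay.

Arguments cohen_macaulay R : clear implicits.
Arguments gorenstein R : clear implicits.

(* f : R -> S is the localization of R at the prime ideal p. *)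
Definition is_localization (R S : comNzRingType) (p : set R)
    (f : {rmorphism R -> S}) : Prop :=
  [/\ forall s, ~ p s -> exists t, f s * t = 1,
      forall y, exists r s, ~ p s /\ y * f s = f r &
      forall r, f r = 0 <-> exists2 s, ~ p s & s * r = 0].

Definition generically_gorenstein (R : comNzRingType) : Prop :=
  forall p : set R, minimal_prime p ->
    exists (S : comNzRingType) (f : {rmorphism R -> S}),
      is_localization p f /\ gorenstein S.

Definition canonical_ideal (R : comNzRingType) (w : submodClosed R^o) : Prop :=
  exists W : lmodType R, canonical_module W /\ lin_iso W (submodule_type w).

(** * Canonical reduction number *)

Definition almost_reduction (R : comNzRingType) (a : R) (I : set R) : Prop :=
  exists m, ideal_pow I m.+1 = ideal_scale a (ideal_pow I m).

(* The infimum of A, with None standing for the infimum of the empty set. *)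
Definition nat_inf (A : set nat) : option nat :=
  if pselect (exists n, n \in A) is left exA then Some (ex_minn exA) else None.

Definition can_red (R : comNzRingType) : option nat :=
  nat_inf [set n | exists (w : submodClosed R^o) (a : R),
    [/\ canonical_ideal w,
        almost_reduction a [set` w] &
        ideal_pow [set` w] n.+1 = ideal_scale a (ideal_pow [set` w] n)]].

(* x <= n, where None stands for infinity. *)
Definition le_extnat (x : option nat) (n : nat) : Prop :=
  if x is Some m then (m <= n)%N else False.

(* Main.v *)
Require Import Defs.
From HB Require Import structures.
From mathcomp Require Import all_boot all_order all_algebra.
From mathcomp Require Import all_classical.
From mathcomp Require Import perm ring.

(* Fix an R-regular x in the maximal ideal m.  Descending along a finite
   injective resolution of a canonical module W, Ext^1(R/J, W_i) = 0 for every
   cosyzygy W_i with i >= 1 and every ideal J containing x; hence Ext^1(C, W) = 0 for C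
   maximal Cohen-Macaulay (Nakayama), which together with the simplicity of the
   socle of W/xW gives End(W) = R, the uniqueness of W, and the reflexivity of
   syzygies M of maximal Cohen-Macaulay modules with respect to D = Hom(-, W).
   Moreover every M -> w is then a sum of maps M -> R -> w.

   If DM is a syzygy, applying this to the evaluations DM -> w shows that M is a
   sum of images of w, so tr(M) is contained in tr(w).  Conversely let
   w^3 = a w^2 and K = w/a, so that B = K^2 is a ring containing K.  Since
   K : K = R, one gets tr(w) B <= R; if tr(M) <= tr(w), then M^*, hence
   DM = w M^*, hence M = DDM, is a B-module, so K M = M and M is a sum of images
   of w.  Dualizing w^n -> M then exhibits DM as a syzygy. *)

Set Implicit Arguments.
Unset Strict Implicit.
Unset Printing Implicit Defensive.

Import GRing.Theory.

Local Open Scope classical_set_scope.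
Local Open Scope ring_scope.

(** * Submodules and linear maps *)

(** Finite injective dimension is a resolution of arbitrary finite length, so the vanishing of Ext^1
    is carried down from its far end. The descent stops at the first cosyzygy: those of positive
    index are images of injective modules, hence divisible by x, while W is not; Nakayama bridges
    the last gap. The bound on the reduction number yields a reduction of some canonical ideal,
    perhaps not of w. Uniqueness of W is therefore needed, but only as surjections both ways, under
    which traces are monotone. But K^2 is finitely generated, faithful and idempotent, and the
    determinant trick puts 1 in K^2. The exponent 2 gives w B = w K. For a functional on w, seen as
    multiplication by q, this puts q w B = (q w) K inside K; as q w B is stable under K, it lies in
    K : K = R. With w^(n+1) = a w^n the same computation only lands in K^(n-1). Fractions are never
    formed: K and B appear as divisibility by a and a^2. *)

Section SubmoduleTheory.
Variables (R : pzRingType) (V : lmodType R).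
Implicit Types (A B : set V) (s : seq V).

Lemma is_submoduleP A : is_submodule A <->
  A 0 /\ forall a u v, A u -> A v -> A (a *: u + v).
Proof.
split=> [[A0 Alin]|[A0 Alin]]; split.
- by move: A0; rewrite !inE.
- by move=> a u v Au Av; have := Alin a u v; rewrite !inE; apply.
- by rewrite !inE.
- by move=> a u v; rewrite !inE; exact: Alin.
Qed.

Section Closure.
Variables (A : set V) (subA : is_submodule A).

Lemma submod0 : A 0. Proof. by case/is_submoduleP: subA. Qed.

Lemma submodZD a u v : A u -> A v -> A (a *: u + v).
Proof. by case/is_submoduleP: subA => _; apply. Qed.

Lemma submodZ a u : A u -> A (a *: u).
Proof. by move=> Au; rewrite -[_ *: _]addr0; apply: submodZD => //;
  exact: submod0. Qed.

Lemma submodD u v : A u -> A v -> A (u + v).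
Proof. by move=> Au Av; rewrite -[u]scale1r; exact: submodZD. Qed.

Lemma submodN u : A u -> A (- u).
Proof. by move=> Au; rewrite -scaleN1r; exact: submodZ. Qed.

Lemma submodB u v : A u -> A v -> A (u - v).
Proof. by move=> Au Av; apply: submodD => //; exact: submodN. Qed.

Lemma submod_sum (I : Type) (r : seq I) (P : pred I) (F : I -> V) :
  (forall i, P i -> A (F i)) -> A (\sum_(i <- r | P i) F i).
Proof. by move=> AF; apply: big_ind => //; [exact: submod0|exact: submodD]. Qed.

End Closure.

Lemma is_submoduleT : is_submodule [set: V].
Proof. by apply/is_submoduleP; split. Qed.

Lemma is_submoduleI A B : is_submodule A -> is_submodule B ->
  is_submodule (A `&` B).
Proof.
move=> sA sB; apply/is_submoduleP; split=> [|a u v [? ?] [? ?]].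
  by split; exact: submod0.
by split; exact: submodZD.
Qed.

Lemma span_submodule A : is_submodule (submod_span A).
Proof.
apply/is_submoduleP; split=> [B [sB _]|a u v Au Av B sB].
  exact: submod0.
by apply: submodZD; [case: sB|exact: Au|exact: Av].
Qed.

Lemma span_sub A : A `<=` submod_span A.
Proof. exact: sub_gen_smallest. Qed.

Lemma span_min A B : is_submodule B -> A `<=` B -> submod_span A `<=` B.
Proof. by move=> sB AB; exact: smallest_sub. Qed.

Lemma span_seq_sub s B : is_submodule B -> {in s, forall v, B v} ->
  submod_span [set` s] `<=` B.
Proof. by move=> sB sB'; apply: span_min => // v; exact: sB'. Qed.

Lemma span_consP v s p : submod_span [set` v :: s] p ->
  exists a u, submod_span [set` s] u /\ p = a *: v + u.
Proof.
move: p; apply: (span_min (B := [set p | exists a u,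
  submod_span [set` s] u /\ p = a *: v + u])).
  apply/is_submoduleP; split.
    exists 0, 0; split; first exact: submod0 (span_submodule _).
    by rewrite scale0r addr0.
  move=> a p q [b [u [su ->]]] [c [w [sw ->]]].
  exists (a * b + c), (a *: u + w); split.
    exact: submodZD (span_submodule _) _ _ _ _ _.
  by rewrite scalerDr scalerDl scalerA addrACA.
move=> p /=; rewrite inE => /orP[/eqP->|sp].
  exists 1, 0; split; first exact: submod0 (span_submodule _).
  by rewrite scale1r addr0.
exists 0, p; split; first exact: span_sub.
by rewrite scale0r add0r.
Qed.

Lemma submod_span_nil p : submod_span [set` [::] : seq V] p -> p = 0.
Proof.
have s0 : is_submodule [set 0 : V].
  by apply/is_submoduleP; split=> // a u v /= -> ->; rewrite scaler0 addr0.
exact: (@span_seq_sub [::] _ s0 _ p).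
Qed.

Lemma span_seqP s p : submod_span [set` s] p ->
  exists c : nat -> R, p = \sum_(i < size s) c i *: nth 0 s i.
Proof.
elim: s p => [|v s IHs] p.
  by move=> /submod_span_nil ->; exists (fun _ => 0); rewrite big_ord0.
move=> /span_consP[a [u [/IHs [c ->] ->]]].
exists (fun i => if i is j.+1 then c j else a).
by rewrite big_ord_recl.
Qed.

Definition submod_pred A : {pred V} := [in A].

Definition submod_of A (sA : is_submodule A) : submodClosed V :=
  HB.pack_for (submodClosed V) (submod_pred A)
    (GRing.isSubmodClosed.Build R V (submod_pred A)
      (GRing.submod_closed_semi sA)).

Lemma in_submod_of A (sA : is_submodule A) v : (v \in submod_of sA) <-> A v.
Proof. by rewrite unfold_in /= in_setE. Qed.

Lemma submodClosed_submodule (S : submodClosed V) : is_submodule [set` S].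
Proof.
have [S0 Slin] := GRing.submodClosedP S.
by apply/is_submoduleP; split=> // a u v; exact: Slin.
Qed.

End SubmoduleTheory.

Section LinearMaps.
Variable (R : comNzRingType).
Implicit Types M N : lmodType R.

(** Partial maps are total functions that are linear only on [A], so that a domain can grow one
    generator at a time without a change of type. *)
Definition lin_on M N (A : set M) (f : M -> N) : Prop :=
  forall a u v, A u -> A v -> f (a *: u + v) = a *: f u + f v.

Definition mk_linear M N (f : M -> N) (lin_f : linear f) : {linear M -> N} :=
  HB.pack_for {linear M -> N} f (GRing.isLinear.Build R M N *:%R f lin_f).

Section LinOn.
Variables (M N : lmodType R) (A : set M) (f : M -> N).
Hypotheses (sA : is_submodule A) (linf : lin_on A f).

Lemma lin_on0 : f 0 = 0.
Proof.
have := linf 1 (submod0 sA) (submod0 sA).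
rewrite !scale1r addr0 => /(congr1 (fun z => z - f 0)).
by rewrite subrr addrK => <-.
Qed.

Lemma lin_onZ a u : A u -> f (a *: u) = a *: f u.
Proof.
move=> Au; rewrite -[a *: u]addr0 linf ?lin_on0 ?addr0 //; exact: submod0.
Qed.

Lemma lin_onB u v : A u -> A v -> f (u - v) = f u - f v.
Proof.
by move=> Au Av; have := linf (-1) Av Au; rewrite !scaleN1r addrC => ->;
  rewrite addrC.
Qed.

End LinOn.

Lemma is_submodule_preim M N (f : {linear M -> N}) (B : set N) :
  is_submodule B -> is_submodule (f @^-1` B).
Proof.
move=> sB; apply/is_submoduleP; split=> [|a u v Bu Bv] /=.
  by rewrite linear0; exact: submod0.
by rewrite linearP; exact: submodZD.
Qed.

Lemma is_submodule_image M N (f : {linear M -> N}) (A : set M) :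
  is_submodule A -> is_submodule (f @` A).
Proof.
move=> sA; apply/is_submoduleP; split=> [|a _ _ [u Au <-] [v Av <-]].
  by exists 0; [exact: submod0|rewrite linear0].
by exists (a *: u + v); [exact: submodZD|rewrite linearP].
Qed.

Lemma is_submodule0 M : is_submodule [set 0 : M].
Proof. by apply/is_submoduleP; split=> // a u v /= -> ->;
  rewrite scaler0 addr0. Qed.

Lemma is_submodule_ker M N (f : {linear M -> N}) : is_submodule (lin_ker f).
Proof.
by apply/is_submoduleP; split=> [|a u v /= fu fv];
  rewrite /lin_ker /= ?linear0 // linearP fu fv scaler0 addr0.
Qed.

Lemma span_image M N (f : {linear M -> N}) (s : seq M) y :
  submod_span [set` map f s] y -> exists2 x, submod_span [set` s] x & f x = y.
Proof.
apply: (span_seq_sub (is_submodule_image f (span_submodule [set` s]))).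
by move=> _ /mapP[x sx ->]; exists x => //; exact: span_sub.
Qed.

Lemma submodule_val_linear M (S : submodClosed M) :
  linear (@submodule_val R M S).
Proof. by []. Qed.

Definition submod_incl M (S : submodClosed M) : {linear submodule_type S ->
  M} :=
  mk_linear (@submodule_val_linear M S).

Lemma submodule_valP M (S : submodClosed M) (u : submodule_type S) :
  submodule_val u \in S.
Proof. by case: u. Qed.

Lemma submodule_val_inj M (S : submodClosed M) :
  injective (@submodule_val R M S).
Proof. exact: val_inj. Qed.

Lemma corestrict M N (f : {linear M -> N}) (S : submodClosed N) :
  (forall x, f x \in S) ->
  exists g : {linear M -> submodule_type S}, forall x,
    submodule_val (g x) = f x.
Proof.
move=> fS.
have lin_g : linear (fun x => SubmoduleType (fS x)).
  by move=> a u v; apply: submodule_val_inj; rewrite /= linearP.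
by exists (mk_linear lin_g).
Qed.

End LinearMaps.

Section Extension.
Variable (R : comNzRingType).
Implicit Types M N P I : lmodType R.

Lemma injective_extend P I (A : set P) (f : P -> I) :
  injective_module I -> is_submodule A -> lin_on A f ->
  exists h : {linear P -> I}, forall p, A p -> h p = f p.
Proof.
move=> injI sA linf.
pose S := submod_of sA.
have lin_g : linear (fun u : submodule_type S => f (submodule_val u)).
  move=> a u v; apply: linf; apply/(in_submod_of sA); exact: submodule_valP.
have [h hE] := injI _ _ (submod_incl S) (mk_linear lin_g) (@submodule_val_inj _
  _ S).
exists h => p Ap; have Sp : p \in S by apply/in_submod_of.
exact: (hE (SubmoduleType Sp)).
Qed.

(** The lifting property speaks of surjective maps only, so both maps are corestricted to the range
    of [g]. *)
Lemma projective_lift P M N (f : {linear P -> N}) (g : {linear M -> N}) :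
  projective_module P -> (forall p, range g (f p)) ->
  exists h : {linear P -> M}, forall p, g (h p) = f p.
Proof.
move=> projP fg.
pose S := submod_of (is_submodule_image g (is_submoduleT M)).
have [f' f'E] : exists f' : {linear P -> submodule_type S},
    forall x, submodule_val (f' x) = f x.
  by apply: corestrict => x; apply/in_submod_of; exact: fg.
have [g' g'E] : exists g' : {linear M -> submodule_type S},
    forall x, submodule_val (g' x) = g x.
  by apply: corestrict => x; apply/in_submod_of; exists x.
have [|h hE] := projP _ _ g' f'.
  apply/seteqP; split=> // y _.
  have /in_submod_of[x _ xy] := submodule_valP y.
  by exists x => //; apply: submodule_val_inj; rewrite g'E.
by exists h => p; rewrite -g'E -f'E; congr submodule_val; exact: hE.
Qed.

End Extension.

(** * Noetherian modules *)

Section NoetherianModules.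
Variable (R : comNzRingType).
Implicit Types V W : lmodType R.

(** Stated inside [V], relative to [A], so that cutting down to successive kernels never changes the
    ambient module. *)
Definition noeth_submod V (A : set V) : Prop :=
  forall B, is_submodule B -> B `<=` A ->
    exists s : seq V, submod_span [set` s] = B.

Definition noeth_module V : Prop := noeth_submod [set: V].

(** Otherwise a strictly increasing sequence can be chosen, and finitely many generators of its
    union already lie in one term. *)
Lemma noeth_maximal V (F : set (set V)) :
  noeth_module V -> (forall A, F A -> is_submodule A) -> F !=set0 ->
  exists2 A, F A & forall B, F B -> A `<=` B -> B `<=` A.
Proof.
move=> noethV subF [A0 FA0]; apply: contrapT => nomax.
have step (u : {A | F A}) : {v : {A | F A} |
    sval u `<=` sval v /\ ~ (sval v `<=` sval u)}.
  case: u => A FA /=; apply/cid; apply: contrapT => noext.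
  apply: nomax; exists A => // B FB AB; apply: contrapT => nBA.
  by apply: noext; exists (exist _ B FB).
pose g n := iter n (fun u => sval (step u)) (exist _ A0 FA0).
have gS n : sval (g n) `<=` sval (g n.+1) by rewrite /g iterS;
  case: (svalP (step (g n))).
have gmono m n : (m <= n)%N -> sval (g m) `<=` sval (g n).
  move=> /subnK <-; elim: (n - m)%N => [|k IHk] //.
  exact: subset_trans IHk (gS _).
have subg n : is_submodule (sval (g n)) by apply: subF; exact: (svalP (g n)).
pose U := \bigcup_n sval (g n).
have subU : is_submodule U.
  apply/is_submoduleP; split; first by exists 0%N => //; exact: submod0.
  move=> a u v [m _ um] [n _ vn]; exists (maxn m n) => //.
  apply: submodZD => //.
    exact: gmono (leq_maxl m n) _ um.
  exact: gmono (leq_maxr m n) _ vn.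
have [|s sU] := noethV U subU; first by [].
have [N sN] : exists N, {in s, forall v, sval (g N) v}.
  have : {in s, forall v, U v} by move=> v sv; rewrite -sU; exact: span_sub.
  elim: (s) => [|v t IHt] Ut; first by exists 0%N.
  have [N tN] := IHt (fun z zt => Ut z (mem_behead (s := v :: t) zt)).
  have [n _ vn] := Ut v (mem_head v t).
  exists (maxn N n) => z; rewrite inE => /orP[/eqP->|zt].
    exact: gmono (leq_maxr N n) _ vn.
  exact: gmono (leq_maxl N n) _ (tN _ zt).
have [_] := svalP (step (g N)); apply => v vN.
apply: (span_seq_sub (subg N) sN); rewrite sU.
by exists N.+1.
Qed.

Lemma noeth_submod_ker V W (f : {linear V -> W}) (A : set V) :
  noeth_module W -> noeth_submod (A `&` lin_ker f) -> noeth_submod A.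
Proof.
move=> noethW noethK B sB BA.
have [||t tE] := noethW (f @` B); [exact: is_submodule_image|by []|].
have [s0 s0B s0t] : exists2 s0 : seq V, {in s0, forall v, B v} & map f s0 = t.
  have : {in t, forall y, (f @` B) y} by move=> y ty; rewrite -tE;
    exact: span_sub.
  elim: (t) => [|y t' IHt] tB; first by exists [::].
  have [s0 s0B s0t] := IHt (fun z zt => tB z (mem_behead (s := y :: t') zt)).
  have [b Bb fb] := tB y (mem_head y t').
  exists (b :: s0); last by rewrite /= fb s0t.
  by move=> z; rewrite inE => /orP[/eqP->//|/s0B].
have [||s1 s1E] := noethK (B `&` lin_ker f).
- by apply: is_submoduleI => //; exact: is_submodule_ker.
- by move=> v [Bv kv]; split=> //; exact: BA.
exists (s0 ++ s1); apply/seteqP; split.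
  apply: span_seq_sub => // v; rewrite mem_cat => /orP[/s0B//|sv].
  have : (B `&` lin_ker f) v by rewrite -s1E; exact: span_sub.
  by case.
move=> b Bb; have : (f @` B) (f b) by exists b.
rewrite -tE -s0t => /span_image[c sc fc].
have sub0 : submod_span [set` s0] `<=` submod_span [set` s0 ++ s1].
  apply: span_seq_sub; first exact: span_submodule.
  by move=> v sv; apply: span_sub; rewrite /= mem_cat sv.
have sub1 : submod_span [set` s1] `<=` submod_span [set` s0 ++ s1].
  apply: span_seq_sub; first exact: span_submodule.
  by move=> v sv; apply: span_sub; rewrite /= mem_cat sv orbT.
have Bc : B c by apply: (span_seq_sub sB s0B).
rewrite -[b](subrK c) addrC; apply: (submodD (span_submodule _));
  first exact: sub0.
apply: sub1; rewrite s1E; split; first exact: submodB.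
by rewrite /lin_ker /= linearB fc subrr.
Qed.

Lemma noeth_submod_kers V W (fs : seq (LinHom V W)) (A : set V) :
  noeth_module W ->
  noeth_submod (A `&` [set v | (forall f : LinHom V W, f \in fs ->
    f v = 0)]) -> noeth_submod A.
Proof.
move=> noethW; elim: fs A => [|f fs IHfs] A noethA.
  by move=> B sB BA; apply: noethA => // v Bv; split; [exact: BA|].
apply: (@noeth_submod_ker _ _ f) => //; apply: IHfs.
move=> B sB BA; apply: noethA => // v /BA[[Av kv] fsv]; split=> // g.
by rewrite inE => /orP[/eqP->//|]; exact: fsv.
Qed.

Lemma noeth_submod0 V (A : set V) : A `<=` [set 0] -> noeth_submod A.
Proof.
move=> A0 B sB BA; exists [::]; apply/seteqP; split.
  exact: span_seq_sub.
by move=> v /BA/A0 ->; exact: submod0 (span_submodule _).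
Qed.

(** The maps [fs] are jointly injective and embed V in a finite power of W, which is never formed.
    This serves free modules and Hom modules alike. *)
Lemma noeth_kers V W (fs : seq (LinHom V W)) : noeth_module W ->
  (forall v, (forall f : LinHom V W, f \in fs -> f v = 0) -> v = 0) ->
    noeth_module V.
Proof.
move=> noethW fs0; apply: (noeth_submod_kers (fs := fs)) => //.
by apply: noeth_submod0 => v [_]; exact: fs0.
Qed.

Lemma noeth_image V W (f : {linear V -> W}) : noeth_module V ->
  range f = setT -> noeth_module W.
Proof.
move=> noethV fT B sB _.
have [||s sE] := noethV (f @^-1` B); [exact: is_submodule_preim|by []|].
exists (map f s); apply/seteqP; split.
  apply: span_seq_sub => // _ /mapP[v sv ->].
  by have : (f @^-1` B) v by rewrite -sE; exact: span_sub.
move=> y By; have [v _ vy] : range f y by rewrite fT.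
have : (f @^-1` B) v by rewrite /= vy.
rewrite -sE -vy -/((f @^-1` _) v) => sv.
apply: (span_seq_sub (is_submodule_preim f (span_submodule [set` map f s])) _
  sv).
by move=> u su; apply: span_sub; rewrite /= map_f.
Qed.

Definition rowcomb V n (e : 'I_n -> V) (r : 'rV[R]_n) : V :=
  \sum_i r 0 i *: e i.

Lemma rowcomb_is_linear V n (e : 'I_n -> V) : linear (rowcomb e).
Proof.
move=> a u v; rewrite /rowcomb scaler_sumr -big_split /=.
by apply: eq_bigr => i _; rewrite !mxE scalerDl scalerA.
Qed.

HB.instance Definition _ V n (e : 'I_n -> V) :=
  GRing.isLinear.Build R 'rV[R]_n V _ (rowcomb e) (rowcomb_is_linear e).

Lemma rowcomb_delta V n (e : 'I_n -> V) i : rowcomb e (delta_mx 0 i) = e i.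
Proof.
rewrite /rowcomb (bigD1 i) //= mxE !eqxx scale1r big1 ?addr0 // => j ji.
by rewrite mxE eqxx (negbTE ji) scale0r.
Qed.

Lemma row_coord_linear n (i : 'I_n) :
  linear (fun r : 'rV[R]_n => r 0 i : R^o).
Proof. by move=> a u v; rewrite !mxE. Qed.

Definition row_coord n (i : 'I_n) : {linear 'rV[R]_n -> R^o} :=
  mk_linear (row_coord_linear i).

Lemma noeth_row n : noetherian R -> noeth_module 'rV[R]_n.
Proof.
move=> noethR; apply: (@noeth_kers _ R^o [seq (row_coord i : LinHom _ _) | i <-
  enum 'I_n]).
  by move=> B sB _; exact: noethR.
move=> v kv; apply/rowP => i; rewrite mxE.
by apply: (kv (row_coord i)); apply: map_f; rewrite mem_enum.
Qed.

Lemma fin_genP V : fin_gen V ->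
  exists n (e : 'I_n -> V), forall v, exists r, v = rowcomb e r.
Proof.
move=> [s sT]; exists (size s), (fun i => nth 0 s i) => v.
have /span_seqP[c ->] : submod_span [set` s] v by rewrite sT.
by exists (\row_i c i); apply: eq_bigr => i _; rewrite mxE.
Qed.

Lemma fin_gen_noeth V : noetherian R -> fin_gen V -> noeth_module V.
Proof.
move=> noethR /fin_genP[n [e eV]].
apply: (noeth_image (f := rowcomb e)); first exact: noeth_row.
by apply/seteqP; split=> // v _; have [r ->] := eV v; exists r.
Qed.

Lemma noeth_fin_gen V : noeth_module V -> fin_gen V.
Proof. by move=> noethV; apply: noethV => //; exact: is_submoduleT. Qed.

Lemma noeth_inj V W (f : {linear V -> W}) : noeth_module W -> injective f ->
  noeth_module V.
Proof.
move=> noethW injf; apply: (@noeth_submod_ker _ _ f) => //.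
by apply: noeth_submod0 => v [_ fv]; apply: injf; rewrite fv linear0.
Qed.

Lemma eval_hom_linear V W (v : V) : linear (fun f : LinHom V W => f v).
Proof. by []. Qed.

Definition eval_hom V W (v : V) : {linear LinHom V W -> W} :=
  mk_linear (@eval_hom_linear V W v).

Lemma noeth_LinHom V W : fin_gen V -> noeth_module W ->
  noeth_module (LinHom V W).
Proof.
move=> [s sT] noethW.
apply: (@noeth_kers _ W [seq (eval_hom _ v : LinHom _ _) | v <- s]) => // f fs.
apply: LinHom_eq => v /=.
have : submod_span [set` s] v by rewrite sT.
apply: (span_seq_sub (is_submodule_ker f)) => u su.
exact: (fs (eval_hom _ u) (map_f _ su)).
Qed.

End NoetherianModules.

(** * Ideals of a one-dimensional local ring *)

Section IdealTheory.
Variable (R : comNzRingType).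
Implicit Types (I J p : set R) (V : lmodType R).

Lemma is_idealP I : is_ideal I <->
  I 0 /\ forall a u v, I u -> I v -> I (a * u + v).
Proof. exact: (@is_submoduleP R R^o I). Qed.

Lemma idlM I a u : is_ideal I -> I u -> I (a * u).
Proof. by move=> iI Iu; exact: (@submodZ R R^o I iI a u). Qed.

Lemma idlMr I a u : is_ideal I -> I u -> I (u * a).
Proof. by rewrite mulrC; exact: idlM. Qed.

Lemma idlD I u v : is_ideal I -> I u -> I v -> I (u + v).
Proof. by move=> iI; exact: (@submodD R R^o I iI u v). Qed.

Lemma idl0 I : is_ideal I -> I 0.
Proof. exact: (@submod0 R R^o I). Qed.

Definition principal (x : R) : set R := [set x * a | a in [set: R]].

Lemma principal_ideal x : is_ideal (principal x).
Proof.
apply/is_idealP; split; first by exists 0; rewrite ?mulr0.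
move=> c _ _ [a _ <-] [b _ <-]; exists (c * a + b) => //.
by rewrite mulrDr mulrCA.
Qed.

Lemma principal_mem x : principal x x.
Proof. by exists 1; rewrite ?mulr1. Qed.

Definition colon V (N : set V) (v : V) : set R := [set r | N (r *: v)].

Lemma colon_ideal V (N : set V) v : is_submodule N -> is_ideal (colon N v).
Proof.
move=> sN; apply/is_idealP; split=> [|a r s Nr Ns]; rewrite /colon /=.
  by rewrite scale0r; exact: submod0.
by rewrite scalerDl -scalerA; exact: submodZD.
Qed.

Definition adjoin V (N : set V) (v : V) : set V :=
  [set n + a *: v | n in N & a in [set: R]].

Lemma adjoinP V (N : set V) v u :
  adjoin N v u <-> exists n a, N n /\ u = n + a *: v.
Proof.
split=> [[n Nn [a _ <-]]|[n [a [Nn ->]]]]; first by exists n, a.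
by exists n => //; exists a.
Qed.

Lemma adjoin_submodule V (N : set V) v :
  is_submodule N -> is_submodule (adjoin N v).
Proof.
move=> sN; apply/is_submoduleP; split.
  by apply/adjoinP; exists 0, 0; rewrite scale0r addr0; split=> //;
    exact: submod0.
move=> c _ _ /adjoinP[n [a [Nn ->]]] /adjoinP[k [b [Nk ->]]].
apply/adjoinP; exists (c *: n + k), (c * a + b); split; first exact: submodZD.
by rewrite scalerDr scalerDl scalerA addrACA.
Qed.

Lemma adjoin_sub V (N : set V) v : N `<=` adjoin N v.
Proof. by move=> n Nn; apply/adjoinP; exists n, 0; rewrite scale0r addr0. Qed.

Lemma adjoin_mem V (N : set V) v : is_submodule N -> adjoin N v v.
Proof.
move=> sN; apply/adjoinP; exists 0, 1; split; first exact: submod0.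
by rewrite scale1r add0r.
Qed.

Definition regular_on V (x : R) : Prop := forall v : V, x *: v = 0 -> v = 0.

Lemma regular_on_inj V x : regular_on V x -> injective (fun v : V => x *: v).
Proof.
move=> regx u v uv; apply/subr0_eq/regx.
by rewrite scalerBr uv subrr.
Qed.

End IdealTheory.
Arguments regular_on {R} V x.

Section LocalRing.
Variables (R : comNzRingType) (noethR : noetherian R) (localR : local_ring R).
Implicit Types (I J p q : set R) (V : lmodType R).
Local Notation m := (max_ideal R).

Lemma ideal_maximal (F : set (set R)) :
  (forall I, F I -> is_ideal I) -> F !=set0 ->
  exists2 I, F I & forall J, F J -> I `<=` J -> J `<=` I.
Proof. by apply: (@noeth_maximal R R^o F) => B sB _; exact: noethR. Qed.

Lemma max_ideal_maximal : maximal_ideal m.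
Proof.
have [M [maxM uniqM]] := localR.
suff -> : m = M by [].
apply/seteqP; split=> [a|a Ma N /uniqM <-//]; exact.
Qed.

Lemma max_ideal_ideal : is_ideal m.
Proof. by case: max_ideal_maximal. Qed.

Lemma idl1 I : is_ideal I -> I 1 -> I = setT.
Proof.
move=> iI I1; apply/seteqP; split=> // a _.
by rewrite -[a]mulr1; exact: idlM.
Qed.

Lemma max_ideal1 : ~ m 1.
Proof. by case: max_ideal_maximal => im mT _ /(idl1 im). Qed.

Lemma proper_sub_max I : is_ideal I -> ~ I 1 -> I `<=` m.
Proof.
move=> iI nI1.
pose F := [set J | is_ideal J /\ I `<=` J /\ ~ J 1].
have [|| M [iM [IM nM1]] maxM] := @ideal_maximal F.
- by move=> J [].
- by exists I; split=> //; split=> // a.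
have MM : maximal_ideal M.
  split=> // [MT|J iJ MJ]; first by apply: nM1; rewrite MT.
  have [J1|nJ1] := pselect (J 1); first by right; exact: idl1.
  left; apply/seteqP; split=> //; apply: maxM => //.
  by split=> //; split=> //; exact: subset_trans MJ.
have [M' [_ uniqM]] := localR.
by rewrite (_ : m = M) // -(uniqM _ MM) (uniqM _ max_ideal_maximal).
Qed.

Lemma not_max_unit u : ~ m u -> exists v, u * v = 1.
Proof.
move=> nmu; have [[v _ uv]|nu1] := pselect (principal u 1); first by exists v.
case: nmu; apply: (proper_sub_max (principal_ideal u) nu1).
exact: principal_mem.
Qed.

Lemma max_ideal_prime : prime_ideal m.
Proof.
split; [exact: max_ideal_ideal|exact: max_ideal1|move=> x y mxy].
have [|/not_max_unit[v xv]] := pselect (m x); first by left.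
right; rewrite -[y]mul1r -xv mulrAC mulrC mulrA.
by have := idlM v max_ideal_ideal mxy; rewrite mulrA.
Qed.

Lemma sub1_max_unit x : m x -> exists v, (1 - x) * v = 1.
Proof.
move=> mx; apply: not_max_unit => m1x; apply: max_ideal1.
by rewrite -(subrK x 1); exact: (idlD max_ideal_ideal).
Qed.

(** Generators of A are dropped one at a time modulo N: rewriting [h] as an element of N + x A makes
    (1 - x a) h a combination of the others, and 1 - x a is a unit. *)
Lemma nakayama V (A N : set V) x :
  is_submodule N -> m x ->
  (exists s : seq V, submod_span [set` s] = A) ->
  (forall v, A v -> exists n u, [/\ N n, A u & v = n + x *: u]) ->
  A `<=` N.
Proof.
move=> sN mx [s sA] AN.
have sAA : is_submodule A by rewrite -sA; exact: span_submodule.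
suff H (t : seq V) : {in t, forall v, A v} ->
    (forall v, A v -> exists n u, [/\ N n,
      submod_span [set` t] u & v = n + u]) ->
    A `<=` N.
  apply: (H s) => [v sv|v Av]; first by rewrite -sA; exact: span_sub.
  by exists 0, v; rewrite add0r sA; split=> //; exact: submod0.
elim: t => [|h t IHt] tA At v.
  by move=> /At[n [u [Nn /submod_span_nil -> ->]]]; rewrite addr0.
apply: IHt v => [z zt|v Av]; first by apply: tA; rewrite inE zt orbT.
have [n [h' [Nn Ah' hE]]] := AN _ (tA _ (mem_head h t)).
have [n' [_ [Nn' /span_consP[a [u [tu ->]]] h'E]]] := At _ Ah'.
have [c uc] : exists c, (1 - x * a) * c = 1.
  by apply: sub1_max_unit; exact: (idlMr a max_ideal_ideal mx).
have {}hE : h = c *: (n + x *: n') + (c * x) *: u.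
  have : (1 - x * a) *: h = n + x *: n' + x *: u.
    rewrite scalerBl scale1r {1}hE h'E !scalerDr scalerA !addrA.
    by rewrite addrAC addrK.
  move=> /(congr1 (fun z => c *: z)).
  by rewrite scalerA mulrC uc scale1r scalerDr scalerA.
have [n1 [_ [Nn1 /span_consP[b [w [tw ->]]] vE]]] := At _ Av.
exists (n1 + b *: (c *: (n + x *: n'))), (b *: ((c * x) *: u) + w); split.
- apply: submodD => //; apply: submodZ => //; apply: submodZ => //.
  by apply: submodD => //; exact: submodZ.
- have st := span_submodule [set` t].
  by apply: (submodD st) => //; do 2!apply: (submodZ st).
- by rewrite vE {1}hE scalerDr !addrA.
Qed.

(** Associated primes of V / N: a colon ideal of r v that is maximal among those with r v outside N
    is prime. *)
Lemma colon_prime V (N : set V) v : is_submodule N -> ~ N v ->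
  exists r, ~ N (r *: v) /\ prime_ideal (colon N (r *: v)).
Proof.
move=> sN nNv.
pose F := [set I | exists r, ~ N (r *: v) /\ I = colon N (r *: v)].
have [||I [r [nNr ->]] maxI] := @ideal_maximal F.
- by move=> I [r [_ ->]]; exact: colon_ideal.
- by exists (colon N (1 *: v)), 1; split=> //; rewrite scale1r.
exists r; split=> //; split; first exact: colon_ideal.
  by rewrite /colon /= scale1r.
move=> a b Nab; have [|nNb] := pselect (colon N (r *: v) b); first by right.
left; apply: (maxI (colon N ((b * r) *: v))).
- by exists (b * r); rewrite -scalerA.
- move=> c Nc; rewrite /colon /= !scalerA mulrCA -scalerA.
  by apply: submodZ => //; rewrite -scalerA.
- by move: Nab; rewrite /colon /= !scalerA mulrA.
Qed.

Hypothesis dimR : has_krull_dim R 1.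

Lemma prime_sub_max p : prime_ideal p -> p `<=` m.
Proof. by case=> ip np1 _; exact: proper_sub_max. Qed.

Lemma nonmax_prime_minimal p q : prime_ideal p -> prime_ideal q ->
  q `<=` p -> ~ m `<=` p -> p `<=` q.
Proof.
move=> pp pq qp nmp; apply: contrapT => npq.
have [_ dim1] := dimR.
suff /dim1 : @prime_chain R 2 by [].
exists (fun i => match i with 0 => q | 1 => p | _ => m end)%N; split.
  by case=> [|[|[|]]] // _; exact: max_ideal_prime.
by case=> [|[|]] // _; split=> //; exact: prime_sub_max.
Qed.

(** This is nilpotence of y in the localization at p. If it failed, an ideal maximal among those
    avoiding all y^n t with t outside p would be a prime inside p without y, against dimension
    one. *)
Lemma nonmax_prime_nilp p y : prime_ideal p -> ~ m `<=` p -> p y ->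
  exists t n, ~ p t /\ y ^+ n * t = 0.
Proof.
move=> pp nmp py; have [ip np1 pM] := pp.
apply: contrapT => noS.
pose S z := exists t n, ~ p t /\ z = y ^+ n * t.
pose F := [set I | is_ideal I /\ forall z, S z -> ~ I z].
have [||q [iq qS] maxq] := @ideal_maximal F.
- by move=> I [].
- exists [set 0]; split; first exact: (@is_submodule0 R R^o).
  by move=> z [t [n [pt ->]]] z0; apply: noS; exists t, n.
have S1 : S 1 by exists 1, 0%N; rewrite expr0 mulr1.
have Sy : S y by exists 1, 1%N; rewrite expr1 mulr1.
have SM z z' : S z -> S z' -> S (z * z').
  move=> [t [n [pt ->]]] [t' [n' [pt' ->]]].
  by exists (t * t'), (n + n')%N; split; [case/pM|rewrite exprD; ring].
have meet a : ~ q a -> exists2 z, S z & exists b r, q b /\ z = b + r * a.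
  move=> nqa; apply: contrapT => noz; apply: nqa.
  apply: (maxq (adjoin (V := R^o) q a)).
  - split; first exact: (@adjoin_submodule R R^o).
    move=> z Sz /(@adjoinP R R^o)[b [r [qb zE]]]; apply: noz.
    by exists z => //; exists b, r.
  - exact: (@adjoin_sub R R^o).
  - exact: (@adjoin_mem R R^o).
have pq : prime_ideal q.
  split=> //; first exact: qS.
  move=> a b qab; have [|nqa] := pselect (q a); first by left.
  have [|nqb] := pselect (q b); first by right.
  have [z Sz [c [r [qc zE]]]] := meet _ nqa.
  have [z' Sz' [c' [r' [qc' zE']]]] := meet _ nqb.
  case: (qS _ (SM _ _ Sz Sz')).
  have -> : z * z' = (c' + r' * b) * c + (r * a * c' + r * r' * (a * b)).
    by rewrite zE zE'; ring.
  by do ?apply: idlD => //; exact: idlM.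
have qp : q `<=` p.
  move=> r qr; apply: contrapT => npr; apply: qS qr.
  by exists r, 0%N; rewrite expr0 mul1r.
exact: (qS _ Sy (nonmax_prime_minimal pp pq qp nmp py)).
Qed.

Lemma nonmax_prime_ann p : prime_ideal p -> ~ m `<=` p ->
  exists2 t, t != 0 & forall r, p r -> r * t = 0.
Proof.
move=> pp nmp; have [ip np1 pM] := pp.
have [s sp] := noethR ip.
have sP : {in s, forall y, p y} by move=> y sy; rewrite -sp; exact: span_sub.
have [T nT Tnil] : exists2 T, ~ p T &
    {in s, forall y, exists n, y ^+ n * T = 0}.
  elim: (s) sP => [|y s' IHs] sP; first by exists 1.
  have [T nT Tnil] := IHs (fun z zs => sP z (mem_behead (s := y :: s') zs)).
  have [t [n [nt ynt]]] := nonmax_prime_nilp pp nmp (sP y (mem_head _ _)).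
  exists (T * t); first by case/pM.
  move=> z; rewrite inE => /orP[/eqP->|/Tnil[k zk]].
    by exists n; rewrite mulrCA ynt mulr0.
  by exists k; rewrite mulrA zk mul0r.
have T0 : T != 0 by apply: contra_notN nT => /eqP ->; exact: idl0.
(* For each generator y the last nonzero multiple y^k c T is kept: it is killed by y, and still by
   the generators already treated. *)
have [c cT sc] : exists2 c, c * T != 0 & {in s, forall y, y * (c * T) = 0}.
  elim: (s) Tnil => [|y s' IHs] Tnil; first by exists 1; rewrite ?mul1r.
  have [c cT sc] := IHs (fun z zs => Tnil z (mem_behead (s := y :: s') zs)).
  have [n yn] := Tnil y (mem_head _ _).
  have : exists k, y ^+ k * (c * T) == 0.
    by exists n; rewrite mulrCA yn mulr0 ?eqxx.
  move=> exk; have [k /eqP kE kmin] := ex_minnP exk.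
  case: k kE kmin => [|k] kE kmin.
    by move: cT; rewrite -kE expr0 mul1r eqxx.
  exists (y ^+ k * c).
    by rewrite -mulrA; apply/negP => /kmin; rewrite ltnn.
  move=> z; rewrite inE => /orP[/eqP->|/sc zc].
    by rewrite -mulrA mulrA -exprS.
  by rewrite -mulrA mulrCA zc mulr0.
exists (c * T) => // r.
have iann : is_ideal [set r | r * (c * T) = 0].
  apply/is_idealP; split; first by rewrite /= mul0r.
  by move=> a u v /= u0 v0; rewrite mulrDl -mulrA u0 v0 mulr0 addr0.
by rewrite -sp; apply: (span_seq_sub (V := R^o) iann); exact: sc.
Qed.

Lemma prime_regular_max p x : prime_ideal p -> p x -> regular_on R^o x ->
  m `<=` p.
Proof.
move=> pp px regx; apply: contrapT => nmp.
have [t [n [nt xnt]]] := nonmax_prime_nilp pp nmp px.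
apply: nt; suff -> : t = 0 by case: pp => ip _ _; exact: idl0.
elim: n xnt => [|n IHn]; first by rewrite expr0 mul1r.
by rewrite exprS -mulrA => /(regx _)/IHn.
Qed.

(** An associated prime of (R v + N) / N contains the R-regular element x, so in dimension one it is
    the maximal ideal. *)
Lemma socle_elt V (N : set V) v x : is_submodule N -> ~ N v ->
  regular_on R^o x -> N (x *: v) ->
  exists2 r, ~ N (r *: v) & forall y, m y -> N (y *: (r *: v)).
Proof.
move=> sN nNv regx Nxv; have [r [nNr pr]] := colon_prime sN nNv.
exists r => //; apply: (prime_regular_max (x := x) pr) => //.
by rewrite /colon /= scalerA mulrC -scalerA; exact: (submodZ sN).
Qed.

Lemma seq_mul_submodule V xs : is_submodule (@seq_mul R xs V).
Proof. exact: span_submodule. Qed.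

Lemma seq_mul_nil V (v : V) : @seq_mul R [::] V v -> v = 0.
Proof.
apply: (span_min (is_submodule0 V)) => u [x xnil _].
by move: xnil; rewrite /= in_nil.
Qed.

Lemma mem_seq_mul V xs x (v : V) : x \in xs -> @seq_mul R xs V (x *: v).
Proof. by move=> xxs; apply: span_sub; exists x => //; exists v. Qed.

Lemma seq_mul1 V x (v : V) : @seq_mul R [:: x] V v -> exists u, v = x *: u.
Proof.
apply: (span_min (B := [set v | exists u, v = x *: u])).
  apply/is_submoduleP; split; first by exists 0; rewrite scaler0.
  move=> a _ _ [u ->] [w ->]; exists (a *: u + w).
  by rewrite scalerDr !scalerA mulrC.
move=> u [y yx [w _ <-]]; exists w.
by move: yx; rewrite /= inE => /eqP ->.
Qed.

Lemma mcm_regular V x : max_cohen_macaulay V -> m x -> regular_on R^o x ->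
  regular_on V x.
Proof.
case=> _ [V0|[d [dV dmax] [[xs [xsm xsreg _] sxs] _]]] mx regx v xv.
  exact: V0.
apply: contrapT => v0.
have d1 : (0 < d)%N by apply: dmax; case: dimR.
have [||||r nrv mrv] := @socle_elt V [set 0] v x => //.
  exact: is_submodule0.
(* The first element of a regular sequence is regular on V, yet it would kill the socle element r
   v. *)
have [y yxs ymul] : exists2 y, y \in xs & forall u : V, y *: u = 0 -> u = 0.
  exists (nth 0 xs 0); first by rewrite mem_nth // sxs.
  move=> u yu; apply: seq_mul_nil; rewrite -(take0 xs).
  apply: xsreg; first by rewrite sxs.
  by rewrite yu; exact: submod0 (seq_mul_submodule _ _).
by apply: nrv; apply: ymul; apply: mrv; exact: xsm.
Qed.

(** The depth is at least 1 by x. Given y1, y2, an associated prime of V / y1 V contains y1, which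
    is regular on V, so it is m; then y2 kills a nonzero element of V / y1 V. *)
Lemma regular_mcm V x : fin_gen V -> m x -> regular_on R^o x ->
  regular_on V x -> max_cohen_macaulay V.
Proof.
move=> fgV mx regx regxV; split=> //.
have [|nzV] := pselect (zero_module V); first by left.
right; exists 1%N => //; split.
  exists [:: x] => //; split.
  - by move=> y; rewrite inE => /eqP ->.
  - case=> // _ y /= => /seq_mul_nil/regxV ->.
    exact: submod0 (seq_mul_submodule _ _).
  - move=> xV; apply: nzV => v.
    apply: (@nakayama V [set: V] [set 0] x) => //; first exact: is_submodule0.
    move=> u _; have : @seq_mul R [:: x] V u by rewrite xV.
    by move=> /seq_mul1[w ->]; exists 0, w; rewrite add0r.
move=> [|y1 [|y2 xs]] // [xsm xsreg xsV]; exfalso; apply: xsV.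
apply/seteqP; split=> // v _; apply: contrapT => nv.
have reg1 : regular_on V y1.
  move=> u yu; apply: seq_mul_nil.
  have := xsreg 0%N isT u; rewrite /= yu; apply.
  exact: submod0 (seq_mul_submodule _ _).
pose N := @seq_mul R [:: y1] V.
have sN : is_submodule N by exact: seq_mul_submodule.
have nNv : ~ N v.
  move=> /seq_mul1[u vE]; apply: nv; rewrite vE; apply: mem_seq_mul.
  exact: mem_head.
have [r [nNr pr]] := colon_prime sN nNv.
have mr : m `<=` colon N (r *: v).
  apply: contrapT => nm.
  have [|t [n [nt ynt]]] := nonmax_prime_nilp (y := y1) pr nm.
    by apply: mem_seq_mul; exact: mem_head.
  apply: nt; rewrite /colon /=; suff -> : t *: (r *: v) = 0 by exact: submod0.
  have : (y1 ^+ n * t) *: (r *: v) = 0 by rewrite ynt scale0r.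
  rewrite -scalerA; elim: n {ynt} => [|n IHn]; first by rewrite expr0 scale1r.
  by rewrite exprS -scalerA => /reg1/IHn.
apply: nNr; have := xsreg 1%N isT (r *: v); rewrite /= ?take0; apply.
by apply: mr; apply: xsm; rewrite !inE eqxx orbT.
Qed.

End LocalRing.

(** * Vanishing of Ext *)

Section HomOperations.
Variables (R : comNzRingType) (M N : lmodType R).
Implicit Types f g : LinHom M N.

Lemma LinHom_addE f g v : (f + g) v = f v + g v. Proof. by []. Qed.
Lemma LinHom_scaleE a f v : (a *: f) v = a *: f v. Proof. by []. Qed.

Lemma factor_through_inj (I : lmodType R) (e : {linear N ->
  I}) (g : {linear M -> I}) :
  injective e -> (forall v, range e (g v)) ->
  exists h : {linear M -> N}, forall v, e (h v) = g v.
Proof.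
move=> inje ge; have /choice[h hE] : forall v, exists y, e y = g v.
  by move=> v; have [y _ yv] := ge v; exists y.
have lin_h : linear h.
  by move=> a u v; apply: inje; rewrite linearP !hE linearP.
by exists (mk_linear lin_h).
Qed.

End HomOperations.

Section PartialMaps.
Variable R : comNzRingType.
Implicit Types P T : lmodType R.

Lemma adjoin_extend P T (N : set P) (f : P -> T) v w :
  is_submodule N -> lin_on N f ->
  (forall r, colon N v r -> f (r *: v) = r *: w) ->
  exists g : P -> T, lin_on (adjoin N v) g /\
    forall n r, N n -> g (n + r *: v) = f n + r *: w.
Proof.
move=> sN linf fw.
have /choice[g gE] : forall p, exists y, forall n r, N n -> p = n + r *: v ->
    y = f n + r *: w.
  move=> p; have [[n0 [r0 [Nn0 pE]]]|nodec] :=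
    pselect (exists n r, N n /\ p = n + r *: v); last first.
    by exists 0 => n r Nn pE; case: nodec; exists n, r.
  exists (f n0 + r0 *: w) => n r Nn; rewrite pE => nr.
  have rv : (r - r0) *: v = n0 - n.
    rewrite scalerBl; apply/eqP; rewrite subr_eq addrAC eq_sym subr_eq.
    by rewrite nr addrC.
  have Nrv : colon N v (r - r0) by rewrite /colon /= rv; exact: submodB.
  have := fw _ Nrv; rewrite rv (lin_onB linf) // scalerBl => /eqP.
  rewrite subr_eq addrAC eq_sym subr_eq => /eqP <-.
  by rewrite addrC.
have gE' n r : N n -> g (n + r *: v) = f n + r *: w by move=> Nn; exact: gE.
exists g; split=> // a _ _ /adjoinP[n [r [Nn ->]]] /adjoinP[k [q [Nk ->]]].
have -> : a *: (n + r *: v) + (k + q *: v) = (a *: n + k) + (a * r + q) *: v.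
  by rewrite scalerDr scalerDl scalerA addrACA.
rewrite !gE' //; last exact: submodZD.
by rewrite linf // scalerDr scalerDl scalerA addrACA.
Qed.

(* Baer's criterion relative to x: only extension from the ideals containing x
   is needed, as the initial domain contains x P. *)
Lemma baer_extend P T (V : set T) (D : set P) (f : P -> T) (x : R) :
  fin_gen P -> is_submodule V -> is_submodule D ->
  (forall (J : set R) (phi : R^o -> T), is_ideal J -> J x -> lin_on (M :=
    R^o) J phi ->
     (forall r, J r -> V (phi r)) -> (exists2 u, V u & phi x = x *: u) ->
     exists2 v, V v & forall r, J r -> phi r = r *: v) ->
  (forall p, D (x *: p)) -> lin_on D f -> (forall p, D p -> V (f p)) ->
  (forall p, exists2 u, V u & f (x *: p) = x *: u) ->
  exists F : {linear P -> T}, (forall p, D p -> F p = f p) /\ forall p, V (F p).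
Proof.
move=> [s sT] sV sD baer xD linf fV fx.
(* Generators of P join the domain one at a time; the colon ideal of each contains x because x P
   lies in [D]. *)
have [D' [g [[sD' DD' sD''] ling gf gV]]] : exists (D' : set P) (g : P -> T),
    [/\ [/\ is_submodule D', D `<=` D' & {in s, forall v, D' v}],
        lin_on D' g, forall p, D p -> g p = f p & forall p, D' p -> V (g p)].
  elim: (s) => [|v t [D' [g [[sD' DD' tD'] ling gf gV]]]].
    by exists D, f; split=> //; split=> // p.
  have [|||||w Vw wE] := baer (colon D' v) (fun r => g (r *: v)).
  - exact: colon_ideal.
  - exact: DD'.
  - by move=> a r q Nr Nq /=; rewrite scalerDl -scalerA ling.
  - by move=> r Nr; exact: gV.
  - by have [u Vu uE] := fx v; exists u => //; rewrite gf.
  have [g' [ling' g'E]] := adjoin_extend sD' ling wE.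
  have g'g p : D' p -> g' p = g p.
    by move=> Dp; rewrite -[p in LHS]addr0 -(scale0r v) g'E // scale0r addr0.
  exists (adjoin D' v), g'; split=> //.
  - split; first exact: adjoin_submodule.
      by move=> p /DD' Dp; exact: adjoin_sub.
    move=> z; rewrite inE => /orP[/eqP->|/tD' Dz]; last exact: adjoin_sub.
    exact: adjoin_mem.
  - by move=> p Dp; rewrite g'g ?gf //; exact: DD'.
  - move=> _ /adjoinP[n [r [Nn ->]]]; rewrite g'E //.
    by apply: (submodD sV); [exact: gV|exact: submodZ].
have D'T p : D' p.
  have : submod_span [set` s] p by rewrite sT.
  exact: (span_seq_sub sD' sD'').
have lin_g : linear g by move=> a u v; exact: ling.
exists (mk_linear lin_g); split=> [p Dp|p] /=; first exact: gf.
by apply: gV; exact: D'T.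
Qed.

Lemma injective_divisible (I : lmodType R) (x : R) (v : I) : injective_module I
  ->
  regular_on R^o x -> exists u : I, x *: u = v.
Proof.
move=> injI regx.
have lin_x : linear (fun r : R^o => x *: r : R^o).
  by move=> a p q; rewrite scalerDr !scalerA mulrC.
have lin_v : linear (fun r : R^o => (r : R) *: v).
  by move=> a p q; rewrite scalerDl scalerA.
have [h hE] := injI _ _ (mk_linear lin_x) (mk_linear lin_v) (regular_on_inj
  regx).
exists (h 1); have := hE 1; rewrite /= scale1r => <-.
by rewrite -linearZ.
Qed.

End PartialMaps.

(** * Vanishing of Ext^1 by descent along a finite injective resolution *)

Section InjectiveResolution.
Variables (R : comNzRingType) (noethR : noetherian R) (localR : local_ring R).
Hypothesis dimR : has_krull_dim R 1.
Local Notation m := (max_ideal R).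
Variables (x : R) (mx : m x) (regx : regular_on R^o x).
Variables (W : lmodType R) (I : nat -> lmodType R) (e : {linear W -> I 0%N}).
Variable d : forall i, {linear I i -> I i.+1}.
Hypothesis resI : injective_resolution e d.

Let dd i v : d i.+1 (d i v) = 0.
Proof.
have [_ _ _ /(_ i) ex] := resI.
have : range (d i) (d i v) by exists v.
by rewrite ex.
Qed.

Let cosyz_range i v : d i.+1 v = 0 -> exists u, d i u = v.
Proof.
have [_ _ _ /(_ i) ex] := resI => dv.
have : lin_ker (d i.+1) v by [].
by rewrite -ex => -[u _ <-]; exists u.
Qed.

Let cosyz_divisible i v : d i.+1 v = 0 -> exists2 u, d i.+1 u = 0 & x *: u = v.
Proof.
move=> /cosyz_range[z <-]; have [injI _ _ _] := resI.
have [z' <-] := injective_divisible z (injI i) regx.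
by exists (d i z') => //; rewrite linearZ.
Qed.

(* Ext^1(R/J, W_i) = 0 for every ideal J containing x, where W_i is the i-th
   cosyzygy of W in the resolution. *)
Definition cosyz_baer i : Prop :=
  forall (J : set R) (phi : R^o -> I i), is_ideal J -> J x -> lin_on (M :=
    R^o) J phi ->
    (forall r, J r -> d i (phi r) = 0) ->
    exists2 v, d i v = 0 & forall r, J r -> phi r = r *: v.

Lemma colon_socle_sub (J : set R) s r : is_ideal J -> ~ J s -> J (r * s) -> m r.
Proof.
move=> iJ nJs Jrs; apply: contrapT => /(not_max_unit noethR localR)[u ru].
by apply: nJs; rewrite -[s]mul1r -ru mulrAC mulrC; exact: (idlM _ iJ).
Qed.

(** Extend phi to R. The obstruction sg = d (h 1) is killed by m and has to be lifted to an element
    of I_(i+1) that m also kills. If s is a socle element of R / x R, every s u with x u = 0 is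
    killed by m. *)
Lemma cosyz_baer_max i (phi : R^o -> I i.+1) : cosyz_baer i.+2 ->
  lin_on (M := R^o) m phi -> (forall r, m r -> d i.+1 (phi r) = 0) ->
  exists2 w, d i.+1 w = 0 & forall r, m r -> phi r = r *: w.
Proof.
move=> baer linphi dphi.
have im : is_ideal m by exact: max_ideal_ideal.
have [injI _ _ _] := resI.
have [h hE] := injective_extend (P := R^o) (injI i.+1) im linphi.
have {}hE r : m r -> phi r = r *: h 1.
  by move=> mr; rewrite -hE // -linearZ /= /GRing.scale /= mulr1.
pose sg := d i.+1 (h 1).
have msg r : m r -> r *: sg = 0.
  by move=> mr; rewrite -linearZ -hE //; exact: dphi.
have [||s0 ns ms] := @socle_elt R noethR localR dimR R^o (principal x) 1 x
    (principal_ideal x) _ regx.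
- by move=> [a _ xa]; apply: (max_ideal1 localR); rewrite -xa;
    exact: (idlMr a im mx).
- by rewrite /GRing.scale /= mulr1; exact: principal_mem.
pose s : R := s0 *: (1 : R^o).
(* The map x |-> 0, s |-> sg is consistent since r s in x R puts r in m. By the hypothesis at i+2 it
   is multiplication by some [tau], so sg = s tau and x tau = 0. *)
have [f [linf fE]] : exists g : R^o -> I i.+2,
    lin_on (M := R^o) (adjoin (V := R^o) (principal x) s) g /\
    forall (n : R) (r : R), principal x n -> g (n + r * s) = 0 + r *: sg.
  apply: (@adjoin_extend R R^o (I i.+2) (principal x) (fun=> 0) s sg).
  - exact: principal_ideal.
  - by move=> a u v _ _; rewrite scaler0 addr0.
  - move=> r xr; rewrite msg //; apply: (colon_socle_sub _ ns xr).
    exact: principal_ideal.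
have xJ : adjoin (V := R^o) (principal x) s x.
  by apply: (@adjoin_sub R R^o); exact: principal_mem.
have sJ : adjoin (V := R^o) (principal x) s s.
  by apply: (@adjoin_mem R R^o); exact: principal_ideal.
have [||||tau dtau tauE] := baer (adjoin (V := R^o) (principal x) s) f.
- by apply: (@adjoin_submodule R R^o); exact: principal_ideal.
- exact: xJ.
- exact: linf.
- move=> _ /(@adjoinP R R^o)[n [r [xn ->]]].
  by rewrite fE // add0r linearZ /= dd scaler0.
have xtau : x *: tau = 0.
  rewrite -tauE //; have := fE x 0 (principal_mem x).
  by rewrite mul0r addr0 scale0r addr0.
have stau : s *: tau = sg.
  rewrite -tauE //; have := fE 0 1 (idl0 (principal_ideal x)).
  by rewrite mul1r scale1r !add0r.
have [t tE] := cosyz_range dtau.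
(* Divisibility of the cosyzygy corrects t to t - t', which is killed by x and still maps to
   [tau]. *)
have [t' dt' xt'] : exists2 u, d i.+1 u = 0 & x *: u = x *: t.
  by apply: cosyz_divisible; rewrite linearZ /= tE.
exists (h 1 - s *: (t - t')).
  by rewrite linearB linearZ linearB /= tE dt' subr0 stau subrr.
move=> r mr; rewrite hE // scalerBr.
have [b _ xb] := ms r mr.
have -> : r *: (s *: (t - t')) = b *: (x *: (t - t')).
  by rewrite !scalerA mulrC [b * x]mulrC xb mulrC.
by rewrite scalerBr xt' subrr scaler0 subr0.
Qed.

(** A maximal bad J is enlarged by a socle element s modulo J. The case of m, applied to r |-> phi
    (r s), supplies the value at s, and J + R s is good. *)
Lemma cosyz_baer_step i : cosyz_baer i.+2 -> cosyz_baer i.+1.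
Proof.
move=> baer; apply: contrapT => nbaer.
pose good (J : set R) := forall phi : R^o -> I i.+1, lin_on (M := R^o) J phi ->
  (forall r, J r -> d i.+1 (phi r) = 0) ->
  exists2 v, d i.+1 v = 0 & forall r, J r -> phi r = r *: v.
pose F := [set J | [/\ is_ideal J, J x & ~ good J]].
have [||J [iJ Jx nJ] maxJ] := ideal_maximal noethR (F := F).
- by move=> J [].
- apply: contrapT => F0; apply: nbaer => J phi iJ Jx.
  by apply: (contrapT (P := good J)) => nJ; apply: F0; exists J.
apply: nJ => phi linphi dphi.
have [J1|nJ1] := pselect (J 1).
  exists (phi 1); first exact: dphi.
  by move=> r Jr; rewrite -(@lin_onZ R R^o _ J phi iJ linphi) // /GRing.scale
    /= mulr1.
have [|s0 ns ms] := @socle_elt R noethR localR dimR R^o J 1 x iJ nJ1 regx.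
  by rewrite /GRing.scale /= mulr1.
pose s : R := s0 *: (1 : R^o).
have im : is_ideal m by exact: max_ideal_ideal.
have [||w dw wE] := @cosyz_baer_max i (fun r => phi (r * s)) baer.
- move=> a u v mu mv; rewrite -linphi; [|exact: ms|exact: ms].
  by congr (phi _); rewrite mulrDl -mulrA.
- by move=> r /ms; exact: dphi.
have [g [ling gE]] := @adjoin_extend R R^o (I i.+1) J phi s w iJ linphi
  (fun r Jrs => wE r (colon_socle_sub iJ ns Jrs)).
have [||v dv vE] := contrapT (P := good (adjoin (V := R^o) J s)) _ g ling.
- move=> nadj; apply: ns; apply: (maxJ (adjoin (V := R^o) J s)).
  + split=> //; first exact: (@adjoin_submodule R R^o).
    exact: (@adjoin_sub R R^o).
  + exact: (@adjoin_sub R R^o).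
  + exact: (@adjoin_mem R R^o).
- move=> _ /(@adjoinP R R^o)[n [r [Jn ->]]].
  by rewrite gE // linearD linearZ /= dw dphi // scaler0 addr0.
exists v => // r Jr; rewrite -vE; last exact: (@adjoin_sub R R^o).
by have := gE r 0 Jr; rewrite !scale0r !addr0 => ->.
Qed.

Hypothesis finI : exists n, forall i, (n < i)%N -> zero_module (I i).

Lemma cosyz_baer1 : cosyz_baer 1.
Proof.
have [n In] := finI.
(* [k] counts the steps down from an index beyond which the modules of the resolution vanish. *)
suff H k i : (n < i + k)%N -> cosyz_baer i.+1.
  by apply: (H n.+1); rewrite addnS ltnS leq_addl.
elim: k i => [|k IHk] i nik; last first.
  by apply: cosyz_baer_step; apply: IHk; rewrite addSnnS.
move=> J phi iJ Jx linphi dphi; exists 0; first by rewrite linear0.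
by move=> r Jr; rewrite scaler0; apply: In; rewrite ltnW // ltnS -(addn0 i).
Qed.

(** By Nakayama on Hom(A, W), it suffices to write each chi : A -> W as a restriction from P plus x
    chi'. Let Phi : P -> I_0 extend e chi, so that theta = d Phi kills A. If theta = x theta' with
    theta' killing A, and Phi' lifts theta', then Phi - x Phi' on P and Phi' on A take values in
    W. *)
Lemma saturated_hom_extend (P : lmodType R) (A : set P) (phi : P -> W) :
  fin_gen W -> fin_gen P -> projective_module P -> is_submodule A ->
  (forall p, A (x *: p) -> A p) -> lin_on A phi ->
  exists psi : {linear P -> W}, forall p, A p -> psi p = phi p.
Proof.
move=> fgW fgP projP sA satA linphi.
have [injI inje ex0 exS] := resI.
pose SA := submodule_type (submod_of sA).
have ASA (u : SA) : A (submodule_val u).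
  by apply/(in_submod_of sA); exact: submodule_valP.
pose res := [set chi : LinHom SA W |
  exists psi : {linear P -> W}, forall u, chi u = psi (submodule_val u)].
have lin0 : linear (fun u : SA => phi (submodule_val u)).
  by move=> a u v; apply: linphi; exact: ASA.
suff H : [set: LinHom SA W] `<=` res.
  have [psi psiE] : res (mk_linear lin0) by exact: H.
  exists psi => p Ap; have Sp : p \in submod_of sA by apply/in_submod_of.
  by have := psiE (SubmoduleType Sp) => /= <-.
have noethP := fin_gen_noeth noethR fgP.
have fgSA : fin_gen SA.
  apply: noeth_fin_gen.
  exact: (noeth_inj (f :=
    submod_incl (submod_of sA)) noethP (@submodule_val_inj _ _ _)).
have noethH : noeth_module (LinHom SA W).
  by apply: noeth_LinHom => //; exact: fin_gen_noeth.
apply: (@nakayama R noethR localR (LinHom SA W) setT res x) => //.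
- apply/is_submoduleP; split; first by exists (0 : LinHom P W).
  move=> a f g [psi psiE] [psi' psi'E].
  by exists (a *: (psi : LinHom P W) + psi') => u;
    rewrite LinHom_addE LinHom_scaleE psiE psi'E.
- by apply: noethH => //; exact: is_submoduleT.
move=> chi _.
have [Phi PhiE] := injI 0%N _ _ (submod_incl (submod_of sA)) (e \o chi)
  (@submodule_val_inj _ _ _).
have {}PhiE (u : SA) : Phi (submodule_val u) = e (chi u) by exact: PhiE.
have de v : d 0%N (e v) = 0.
  have : range e (e v) by exists v.
  by rewrite ex0.
pose theta p := d 0%N (Phi p).
have thetaA p : A p -> theta p = 0.
  move=> Ap; have Sp : p \in submod_of sA by apply/in_submod_of.
  by have := PhiE (SubmoduleType Sp); rewrite /theta /= => ->.
have thetaB p q : theta (p - q) = theta p - theta q.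
  by rewrite /theta !linearB.
(* On A + x P the map theta' is forced to be a + x p |-> theta p. Saturation of A makes this
   consistent, and [cosyz_baer1] extends it to P. *)
pose D := [set q | exists p, A (q - x *: p)].
have sD : is_submodule D.
  apply/is_submoduleP; split.
    by exists 0; rewrite scaler0 subr0; exact: submod0.
  move=> a u v [p Ap] [q Aq]; exists (a *: p + q).
  have -> : a *: u + v - x *: (a *: p + q) = a *: (u - x *: p) + (v - x *: q).
    by rewrite !scalerDr scalerN !scalerA [x * a]mulrC opprD addrACA.
  exact: submodZD.
have /choice[f fE] : forall q, exists y, forall p, A (q - x *: p) ->
  y = theta p.
  move=> q; have [[p0 Ap0]|nD] := pselect (D q); last first.
    by exists 0 => p Ap; case: nD; exists p.
  exists (theta p0) => p Ap; apply/subr0_eq; rewrite -thetaB thetaA //.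
  apply: satA; rewrite scalerBr; have := submodB sA Ap Ap0.
  by rewrite opprB addrC addrA subrK.
have [|||||theta' [theta'f theta'd]] :=
  @baer_extend R P (I 1%N) (lin_ker (d 1%N)) D f x fgP (is_submodule_ker _) sD.
- move=> J psi iJ Jx linpsi psid _.
  by have [v dv vE] := cosyz_baer1 iJ Jx linpsi psid; exists v.
- by move=> p; exists p; rewrite subrr; exact: submod0.
- move=> a u v [p Ap] [q Aq]; rewrite (fE u p) // (fE v q) //.
  have -> : a *: theta p + theta q = theta (a *: p + q) by rewrite /theta
    !linearP.
  apply: fE.
  have -> : a *: u + v - x *: (a *: p + q) = a *: (u - x *: p) + (v - x *: q).
    by rewrite !scalerDr scalerN !scalerA [x * a]mulrC opprD addrACA.
  exact: submodZD.
- by move=> q [p Ap]; rewrite (fE q p) // /lin_ker /= /theta dd.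
- move=> p; rewrite (fE _ p); last by rewrite subrr; exact: submod0.
  by have [u du ux] := cosyz_divisible (dd (Phi p)); exists u.
have theta'x p : x *: theta' p = theta p.
  rewrite -linearZ theta'f; last by exists p; rewrite subrr; exact: submod0.
  by apply: fE; rewrite subrr; exact: submod0.
have theta'A p : A p -> theta' p = 0.
  move=> Ap; have A0 : A (p - x *: 0) by rewrite scaler0 subr0.
  rewrite theta'f; last by exists 0.
  by rewrite (fE _ _ A0) /theta !linear0.
have [|Phi' Phi'E] := projective_lift (f := theta') (g := d 0%N) projP.
  by move=> p; rewrite (exS 0%N); exact: theta'd.
pose Psi : LinHom P (I 0%N) := (Phi : LinHom _ _) - x *: (Phi' : LinHom _ _).
have PsiE p : Psi p = Phi p - x *: Phi' p by [].
have [|psi psiE] := factor_through_inj (g := Psi) inje.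
  move=> p; rewrite ex0 PsiE /lin_ker /= linearB linearZ /= Phi'E theta'x.
  by rewrite subrr.
have [|chi' chi'E] := factor_through_inj (g :=
  Phi' \o submod_incl (submod_of sA)) inje.
  by move=> u; rewrite ex0 /lin_ker /= Phi'E theta'A //; exact: ASA.
pose psiA : LinHom SA W := psi \o submod_incl (submod_of sA).
exists psiA, (chi' : LinHom SA W); split=> //; first by exists psi.
have psiAE (u : SA) : psiA u = psi (submodule_val u) by [].
apply: LinHom_eq => u; apply: inje.
rewrite LinHom_addE LinHom_scaleE linearD linearZ psiAE psiE PsiE chi'E /= PhiE.
by rewrite subrK.
Qed.

End InjectiveResolution.

(** * Canonical modules *)

Section Dualizing.
Variable R : comNzRingType.
Implicit Types W P : lmodType R.

Definition multiples W (x : R) : set W := [set x *: u | u in [set: W]].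

Lemma multiples_submodule W x : is_submodule (multiples (W := W) x).
Proof.
apply/is_submoduleP; split; first by exists 0; rewrite ?scaler0.
move=> a _ _ [u _ <-] [v _ <-]; exists (a *: u + v) => //.
by rewrite scalerDr !scalerA mulrC.
Qed.

Lemma multiplesZ W x (u : W) : multiples x (x *: u).
Proof. by exists u. Qed.

(** The preimage in W of the socle of W / x W, so that the quotient module is never formed. *)
Definition socle_mod W (x : R) : set W :=
  [set v | forall y, max_ideal R y -> multiples x (y *: v)].

Lemma socle_mod_submodule W x : is_submodule (socle_mod (W := W) x).
Proof.
have sX := multiples_submodule W x.
apply/is_submoduleP; split=> [y _|a u v su sv y my].
  by rewrite scaler0; exact: submod0.
rewrite scalerDr scalerA mulrC -scalerA.
by apply: (submodZD sX); [exact: su|exact: sv].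
Qed.

(* The third condition says that Ext^1(C, W) = 0 for every C = P / A on which x
   is regular, and the last two that the socle of W / x W is simple. *)
Definition dualizing (x : R) W : Prop :=
  [/\ fin_gen W,
      regular_on W x,
      forall P (A : set P) (phi : P -> W),
        fin_gen P -> projective_module P -> is_submodule A ->
        (forall p, A (x *: p) -> A p) -> lin_on A phi ->
        exists psi : {linear P -> W}, forall p, A p -> psi p = phi p,
      exists2 v : W, ~ multiples x v & socle_mod x v &
      forall v v' : W, socle_mod x v -> ~ multiples x v -> socle_mod x v' ->
        exists r, multiples x (v' - r *: v)].

Lemma dualizing_iso x W W' : dualizing x W -> lin_iso W W' -> dualizing x W'.
Proof.
move=> [[s sT] regW extW [v nv sv] socW] [f [g fK gK]].
have ling : linear g.
  by move=> a u w; apply: (can_inj fK); rewrite linearP !gK.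
pose g' := mk_linear ling.
have mulf u : multiples x u -> multiples x (f u).
  by move=> [z _ <-]; exists (f z) => //; rewrite linearZ.
have mulg u : multiples x u -> multiples x (g u).
  by move=> [z _ <-]; exists (g z) => //; rewrite -[g]/(g' : _ -> _) linearZ.
have socf u : socle_mod x u -> socle_mod x (f u).
  by move=> su y my; rewrite -linearZ; exact/mulf/su.
have socg u : socle_mod x u -> socle_mod x (g u).
  by move=> su y my; rewrite -[g]/(g' : _ -> _) -linearZ; exact/mulg/su.
split.
- exists (map f s); apply/seteqP; split=> // w _; rewrite -(gK w).
  have : submod_span [set` s] (g w) by rewrite sT.
  apply: (span_seq_sub (is_submodule_preim f (span_submodule [set` map f s]))).
  by move=> u su; apply: span_sub; rewrite /= map_f.
- move=> u xu; rewrite -(gK u) (regW (g u)) ?linear0 //.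
  by rewrite -[g]/(g' : _ -> _) -linearZ xu linear0.
- move=> P A phi fgP projP sA satA linphi.
  have [|psi psiE] := extW P A (g \o phi) fgP projP sA satA.
    by move=> a p q Ap Aq; rewrite /= linphi // -[g]/(g' : _ -> _) linearP.
  by exists (f \o psi) => p Ap; rewrite /= psiE //= gK.
- by exists (f v); [move=> /mulg; rewrite fK|exact: socf].
- move=> u u' su nu su'.
  have [|r rE] := socW (g u) (g u') (socg _ su) _ (socg _ su').
    by move=> /mulf; rewrite gK.
  by exists r; have := mulf _ rE; rewrite linearB linearZ /= !gK.
Qed.

Hypotheses (noethR : noetherian R) (localR : local_ring R).
Hypothesis dimR : has_krull_dim R 1.
Local Notation m := (max_ideal R).
Variables (x : R) (mx : m x) (regx : regular_on R^o x).

Lemma nakayama_multiples W (N : set W) : noeth_module W -> is_submodule N ->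
  (forall v, exists2 n, N n & multiples x (v - n)) -> N = setT.
Proof.
move=> noethW sN Nx; apply/seteqP; split=> //.
apply: (@nakayama R noethR localR W setT N x) => //.
  by apply: noethW => //; exact: is_submoduleT.
move=> v _; have [n Nn [u _ uE]] := Nx v.
by exists n, u; split=> //; rewrite uE addrC subrK.
Qed.

(** The connecting map of 0 -> W -> W -> W / x W -> 0 embeds Hom(k, W / x W), the socle, into
    Ext^1(k, W), which is k. So the socle is at most simple, and it is nonzero because W is. *)
Lemma canonical_dualizing W : canonical_module W -> dualizing x W.
Proof.
move=> [d [k [dimd [q [qlin qT qm]] mcmW [I [e [dI [n [resI In]]]]] extk]]].
have d1 : d = 1%N.
  have [c1 b1] := dimR; have [cd bd] := dimd.
  by apply/eqP; rewrite eqn_leq b1 // bd.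
rewrite {d dimd}d1 in extk.
have [fgW _] := mcmW.
have regW : regular_on W x by exact: (mcm_regular noethR localR dimR mcmW).
have noethW := fin_gen_noeth noethR fgW.
have sX := multiples_submodule W x.
have [P [dP [eP [[projP ePT exP exPS] [qE [qElin qET qEB]]]]]] := extk.
have linq : linear q by move=> a u v; exact: qlin.
pose q' := mk_linear linq.
have qmP r : q r = 0 <-> m r.
  have qmr : ([set: R^o] `&` [set z | q z = 0]) r = m r by rewrite qm.
  by split=> [qr|]; [rewrite -qmr|rewrite -qmr => -[]].
have q1 : q 1 <> 0 by move=> /qmP; exact: (max_ideal1 localR).
have qM a b : q (a * b) = a *: q b.
  by rewrite -[q]/(q' : _ -> _) -linearZ.
have qB a b : q (a - b) = q a - q b by rewrite -[q]/(q' : _ -> _) linearB.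
have qsurj z : exists r, q r = z.
  by have [r _ rz] : (q @` setT) z by [rewrite qT]; exists r.
have [h hE] : exists h : {linear P 0%N -> R^o}, q' \o h =1 eP.
  by apply: projP; exact: qT.
have ePd p : eP (dP 0%N p) = 0.
  have : range (dP 0%N) (dP 0%N p) by exists p.
  by rewrite exP.
have dd p : dP 0%N (dP 1%N p) = 0.
  have : range (dP 1%N) (dP 1%N p) by exists p.
  by rewrite (exPS 0%N).
have mhd p : m (h (dP 0%N p)).
  by apply/qmP; rewrite -[q _]/((q' \o h) _) hE.
have linx : linear (fun v : W => x *: v).
  by move=> a u v; rewrite scalerDr !scalerA mulrC.
(* [f] represents the image of [v] under the connecting map: [h] lifts P_0 -> k to R, h d has values
   in m, and m v is divisible by x. *)
pose connecting (v : W) (f : LinHom (P 1%N) W) :=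
  forall p, x *: f p = (h (dP 0%N p) : R) *: v.
have connect v : socle_mod x v -> exists f, connecting v f.
  move=> sv; have linhv : linear (fun p => (h (dP 0%N p) : R) *: v).
    by move=> a p p'; rewrite !linearP scalerDl scalerA.
  have [|f fE] := @factor_through_inj R (P 1%N) W W (mk_linear linx) (mk_linear
    linhv)
    (regular_on_inj regW).
    by move=> p; have [u _ uE] := sv _ (mhd p); exists u.
  by exists f => p; exact: fE.
have cocycleE v f : connecting v f -> cocycles dP (M := W) (n := 1) f.
  move=> fv p; apply: regW.
  by rewrite fv dd linear0 scale0r.
have [p0 _ p0E] : range eP (q 1) by rewrite ePT.
(* Injectivity: x kills k, so x p0 = d p1 for some p1, and h p0 is 1 modulo m. Evaluating f = g d at
   p1 gives h(p0) v = x g(p0). *)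
have coboundE v f : socle_mod x v -> connecting v f ->
    coboundaries dP (n := 1) f -> multiples x v.
  move=> sv fv [g gE].
  have [p1 _ p1E] : range (dP 0%N) (x *: p0).
    rewrite exP /lin_ker /= linearZ /= p0E -qM mulr1.
    by apply/qmP.
  have hp0 : m (1 - h p0).
    apply/qmP; rewrite qB -[q (h p0)]/((q' \o h) p0) hE p0E.
    by rewrite subrr.
  have fp1 : f p1 = (h p0 : R) *: v.
    by apply: (regular_on_inj regW); rewrite fv p1E linearZ scalerA.
  rewrite -[v]scale1r -[1 : R](subrK (h p0 : R)) scalerDl.
  apply: (submodD sX); first exact: sv.
  by rewrite -fp1 gE p1E linearZ /=; exact: multiplesZ.
split=> //.
- move=> P' A phi; apply: (saturated_hom_extend noethR localR dimR mx regx
    resI) => //.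
  by exists n.
- have nzW : exists w : W, w <> 0.
    apply: contrapT => W0.
    have [f _ fE] : (qE @` cocycles dP (M := W) (n := 1)) (q 1) by rewrite qET.
    apply: q1; rewrite -fE.
    suff : coboundaries dP (n := 1) f by rewrite -qEB => -[].
    exists (0 : LinHom (P 0%N) W) => p; apply: contrapT => fp.
    by apply: W0; exists (f p).
  have [w nw] : exists w : W, ~ multiples x w.
    apply: contrapT => Wx; have [w nw] := nzW; apply: nw.
    suff : [set 0 : W] = setT by move=> W0; have : [set 0 : W] w by rewrite W0.
    apply: nakayama_multiples => //; first exact: is_submodule0.
    by move=> v; exists 0 => //; rewrite subr0; apply: contrapT => nv;
      apply: Wx; exists v.
  have [r nr mr] := socle_elt noethR localR dimR sX nw regx (multiplesZ x w).
  by exists (r *: w).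
- move=> v v' sv nv sv'.
  have [f fv] := connect _ sv; have [f' fv'] := connect _ sv'.
  have cf := cocycleE _ _ fv; have cf' := cocycleE _ _ fv'.
  have nqf : qE f <> 0.
    by move=> qf; apply: nv; apply: (coboundE _ f) => //; rewrite -qEB.
  have [c cE] := qsurj (qE f); have [c1 c1E] := qsurj (qE f').
  have [|b cb] := @not_max_unit R noethR localR c.
    by move=> /qmP; rewrite cE.
  (* [c] is a unit with inverse [b], so the class of f' - a f in k vanishes. *)
  pose a : R := c1 * b; exists a.
  pose F : LinHom (P 1%N) W := - a *: f + f'.
  apply: (coboundE _ F).
  + rewrite addrC -scaleNr -/a.
    by apply: (submodZD (socle_mod_submodule _ _)).
  + move=> p; rewrite LinHom_addE LinHom_scaleE scalerDr scalerA mulrC -scalerA.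
    by rewrite fv fv' scalerBr scaleNr !scalerA [a * _]mulrC addrC.
  + rewrite -qEB; split; last first.
      rewrite /= qElin // -cE -c1E scaleNr -qM /a -mulrA [b * c]mulrC cb mulr1.
      by rewrite addNr.
    move=> p; rewrite LinHom_addE LinHom_scaleE.
    by rewrite cf cf' scaler0 addr0.
Qed.

End Dualizing.

(** * Endomorphisms, faithfulness and uniqueness of a dualizing module *)

Section Duality.
Variables (R : comNzRingType) (noethR : noetherian R) (localR : local_ring R).
Hypothesis dimR : has_krull_dim R 1.
Local Notation m := (max_ideal R).
Variables (x : R) (mx : m x) (regx : regular_on R^o x).
Implicit Types W P T : lmodType R.

Lemma row_projective n : projective_module 'rV[R]_n.
Proof.
move=> M N g f gT.
have /choice[e eE] : forall i, exists u, g u = f (delta_mx 0 i).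
  by move=> i; have [u _ uE] : range g (f (delta_mx 0 i)) by [rewrite gT];
    exists u.
exists (rowcomb e) => r /=.
rewrite {2}(row_sum_delta r) !linear_sum; apply: eq_bigr => i _.
by rewrite !linearZ /= eE.
Qed.

Lemma row_fin_gen n : fin_gen 'rV[R]_n.
Proof.
exists [seq delta_mx 0 i | i <- enum 'I_n]; apply/seteqP; split=> // r _.
rewrite (row_sum_delta r); apply: (submod_sum (span_submodule _)) => i _.
apply: (submodZ (span_submodule _)); apply: span_sub; apply: map_f.
by rewrite mem_enum.
Qed.

Lemma multiples_linear W W' (f : {linear W -> W'}) u :
  multiples x u -> multiples x (f u).
Proof. by move=> [v _ <-]; rewrite linearZ; exact: multiplesZ. Qed.

Lemma socle_coef W (v : W) r : socle_mod x v -> ~ multiples x v ->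
  multiples x (r *: v) -> m r.
Proof.
move=> sv nv rv; apply: contrapT => /(not_max_unit noethR localR)[c rc].
apply: nv; rewrite -[v]scale1r -rc mulrC -scalerA.
exact: (submodZ (multiples_submodule _ _)).
Qed.

(** [phi] encodes a map from the image of [g] to W / x W. It lifts to W because x is regular on that
    image, whose Ext^1 into W vanishes. *)
Lemma regular_lift W P T (g : {linear P -> T}) (phi : {linear P -> W}) :
  dualizing x W -> fin_gen P -> projective_module P -> regular_on T x ->
  (forall p, g p = 0 -> multiples x (phi p)) ->
  exists Phi : {linear P -> W},
    (forall p, multiples x (Phi p - phi p)) /\ forall p, g p = 0 -> Phi p = 0.
Proof.
move=> [_ regW extW _ _] fgP projP regT gphi.
have /choice[chi chiE] : forall p, exists u, g p = 0 -> x *: u = phi p.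
  move=> p; have [/gphi[u _ uE]|ng] := pselect (g p = 0); first by exists u.
  by exists 0.
have [|||psi psiE] := extW P (lin_ker g) chi fgP projP.
- exact: is_submodule_ker.
- by move=> p; rewrite /lin_ker /= linearZ; exact: regT.
- move=> a u v gu gv; apply: (regular_on_inj regW).
  rewrite chiE; last by rewrite linearP gu gv scaler0 addr0.
  by rewrite linearP scalerDr !scalerA mulrC -scalerA !chiE.
pose Phi : LinHom P W := (phi : LinHom P W) - x *: (psi : LinHom P W).
have PhiE p : Phi p = phi p - x *: psi p by [].
exists Phi; split=> p; rewrite PhiE.
  rewrite addrAC subrr add0r -scalerN; exact: multiplesZ.
by move=> gp; rewrite psiE // chiE // subrr.
Qed.

(** Take J maximal without such r and s a socle element modulo J. Modulo x W, s maps the part killed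
    by J into the simple socle, with kernel the part killed by J + R s. There some scalar r' works,
    so phi - r' factors through s and equals rho s. *)
Lemma endomorphism_mod W (phi : {linear W -> W}) (J : set R) :
  dualizing x W -> is_ideal J -> J x ->
  exists r, forall v, (forall j, J j -> multiples x (j *: v)) ->
    multiples x (phi v - r *: v).
Proof.
move=> [_ _ _ _ socW]; move: J.
pose ann (J : set R) := [set v : W | forall j, J j -> multiples x (j *: v)].
pose good J := exists r, forall v, ann J v -> multiples x (phi v - r *: v).
suff H J : is_ideal J -> J x -> good J by move=> J iJ Jx; exact: H.
have sX := multiples_submodule W x.
move=> iJ0 J0x; apply: contrapT => nJ0.
pose F := [set J | [/\ is_ideal J, J x & ~ good J]].
have [||{iJ0 J0x nJ0}J' [iJ Jx nJ] maxJ] := ideal_maximal noethR (F := F).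
- by move=> K [].
- by exists J.
move: J' iJ Jx nJ maxJ => {}J iJ Jx nJ maxJ; apply: nJ.
have [J1|nJ1] := pselect (J 1).
  exists 0 => v /(_ _ J1); rewrite scale1r scale0r subr0.
  exact: multiples_linear.
have [|s0 ns ms] := @socle_elt R noethR localR dimR R^o J 1 x iJ nJ1 regx.
  by rewrite /GRing.scale /= mulr1.
pose s : R := s0 *: (1 : R^o).
have [r' r'E] : good (adjoin (V := R^o) J s).
  apply: contrapT => nadj; apply: ns; apply: (maxJ (adjoin (V := R^o) J s)).
  + split=> //; first exact: (@adjoin_submodule R R^o).
    exact: (@adjoin_sub R R^o).
  + exact: (@adjoin_sub R R^o).
  + exact: (@adjoin_mem R R^o).
have annS v : ann J v -> multiples x (s *: v) -> ann (adjoin (V := R^o) J s) v.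
  move=> Jv sv _ /(@adjoinP R R^o)[j [r [Jj ->]]].
  rewrite scalerDl; apply: (submodD sX); first exact: Jv.
  by rewrite -scalerA; exact: (submodZ sX).
pose psi v := phi v - r' *: v.
have [[v1 [Jv1 nv1]]|nov1] := pselect (exists v,
  ann J v /\ ~ multiples x (s *: v)); last first.
  exists r' => v Jv; apply: r'E; apply: annS => //.
  by apply: contrapT => nsv; apply: nov1; exists v.
have socs v : ann J v -> socle_mod x (s *: v).
  by move=> Jv y my; rewrite scalerA; apply: Jv; exact: ms.
have [rho rhoE] : exists rho, multiples x (psi v1 - rho *: (s *: v1)).
  apply: socW => //; first exact: socs.
  (* The image of v1 lies in the socle because y v1 is killed by J and by s modulo x, where [psi]
     vanishes. *)
  move=> y my; have : multiples x (psi (y *: v1)).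
    apply: r'E; apply: annS; last by rewrite scalerA mulrC -scalerA;
      exact: socs.
    by move=> j Jj; rewrite scalerA mulrC -scalerA; apply: (submodZ sX);
      exact: Jv1.
  by rewrite /psi linearZ /= scalerBr !scalerA mulrC.
exists (r' + rho * s) => v Jv.
have [rho' rho'E] : exists rho', multiples x (s *: v - rho' *: (s *: v1)).
  by apply: socW => //; exact: socs.
have psiu : multiples x (psi (v - rho' *: v1)).
  apply: r'E; apply: annS.
    move=> j Jj; rewrite scalerBr; apply: (submodB sX); first exact: Jv.
    by rewrite scalerA mulrC -scalerA; apply: (submodZ sX); exact: Jv1.
  have -> : s *: (v - rho' *: v1) = s *: v - rho' *: (s *: v1).
    by rewrite scalerBr !scalerA mulrC.
  exact: rho'E.
have lin_psi : linear psi.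
  move=> a u w; rewrite /psi linearP scalerDr scalerBr !scalerA [r' * a]mulrC.
  by rewrite opprD addrACA.
have psivE : psi v = psi (v - rho' *: v1) + rho' *: psi v1.
  by rewrite -[psi]/(mk_linear lin_psi : _ -> _) linearB linearZ subrK.
have -> : phi v - (r' + rho * s) *: v = psi v - rho *: (s *: v).
  by rewrite scalerDl opprD addrA scalerA.
have -> : psi v - rho *: (s *: v) = psi (v - rho' *: v1) +
    (rho' *: (psi v1 - rho *: (s *: v1)) - rho *: (s *: v - rho' *: (s *: v1))).
  rewrite psivE -addrA; congr (_ + _); move: (psi v1) (s *: v1) (s *: v) =>
    p q t.
  by rewrite !scalerBr !scalerA [rho * rho']mulrC opprB addrA subrK.
by apply: (submodD sX) => //; apply: (submodB sX); exact: (submodZ sX).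
Qed.

Lemma endomorphism_scalar W (phi : {linear W -> W}) : dualizing x W ->
  exists r, forall v, phi v = r *: v.
Proof.
move=> dW; have [fgW regW _ _ _] := dW.
have noethW := fin_gen_noeth noethR fgW.
have noethH := noeth_LinHom fgW noethW.
pose scalars := [set chi : LinHom W W | exists r, forall v, chi v = r *: v].
suff H : scalars = setT by have : scalars phi by rewrite H.
apply: (nakayama_multiples noethR localR mx noethH).
  apply/is_submoduleP; split; first by exists 0 => v; rewrite scale0r.
  move=> a f g [r fr] [q gq]; exists (a * r + q) => v.
  by rewrite LinHom_addE LinHom_scaleE fr gq scalerA scalerDl.
move=> chi.
have [r rE] := endomorphism_mod chi dW (principal_ideal x) (principal_mem x).
have lin_r : linear (fun v : W => r *: v).
  by move=> a u v; rewrite scalerDr !scalerA mulrC.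
have lin_x : linear (fun v : W => x *: v).
  by move=> a u v; rewrite scalerDr !scalerA mulrC.
pose n : LinHom W W := mk_linear lin_r.
have [|chi' chi'E] := factor_through_inj (e := mk_linear lin_x) (g := chi - n)
  (regular_on_inj regW).
  move=> v; have [|u _ uE] := rE v; last by exists u.
  by move=> _ [a _ <-]; rewrite -scalerA; exact: multiplesZ.
exists n; first by exists r.
exists (chi' : LinHom W W) => //; apply: LinHom_eq => v.
by rewrite -chi'E.
Qed.

(** It suffices that the annihilator lies in x R: then q = x b with b again an annihilator, since x
    is regular on W, and Nakayama applies. *)
Lemma dualizing_faithful W r : dualizing x W -> (forall v : W,
  r *: v = 0) -> r = 0.
Proof.
move=> dW; have [_ regW _ [v0 nv0 sv0] _] := dW.
pose ann := [set r | forall v : W, r *: v = 0].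
have iann : is_ideal ann.
  apply/is_idealP; split=> [v|a p q p0 q0 v]; first by rewrite scale0r.
  by rewrite scalerDl -scalerA p0 q0 scaler0 addr0.
suff annx q : ann q -> principal x q.
  apply: (@nakayama R noethR localR R^o ann [set 0] x) => //.
  - exact: is_submodule0.
  - exact: noethR.
  move=> q qann; have [b _ bq] := annx q qann.
  exists 0, b; split=> //; last by rewrite add0r.
  by move=> v; apply: regW; rewrite scalerA bq.
move=> qann; apply: contrapT => nq.
have [|s0 ns ms] := @socle_elt R noethR localR dimR R^o (principal x) q x
  (principal_ideal x) nq regx.
  by exists q.
pose s : R := s0 *: (q : R^o).
have sann (v : W) : s *: v = 0.
  have -> : s *: v = s0 *: (q *: v) by rewrite scalerA.
  by rewrite (qann v) scaler0.
(* On the ideal (x, s) the rule x |-> 0, s |-> v0 is consistent modulo x W. Its lift satisfies s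
   Phi(e_0) = x Phi(e_1); as s W = 0, Phi(e_1) = 0, although it is v0 modulo x. *)
have [||Phi [PhiE Phi0]] := @regular_lift W 'rV[R]_2 R^o
  (rowcomb (fun i : 'I_2 => (if i == 0 then x else s) : R^o))
  (rowcomb (fun i : 'I_2 => if i == 0 then 0 else v0)) dW (@row_fin_gen 2)
  (@row_projective 2).
- exact: regx.
- move=> p /=; rewrite /rowcomb !big_ord_recl !big_ord0 /= !addr0 scaler0 add0r.
  move=> pE; apply: sv0;
    apply: (colon_socle_sub noethR localR (principal_ideal x) ns).
  exists (- p 0 0) => //; apply/eqP; rewrite mulrN eq_sym -addr_eq0 addrC mulrC.
  by apply/eqP; exact: pE.
have := PhiE (delta_mx 0 0); rewrite /= rowcomb_delta /= subr0 => -[u _ uE].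
have := PhiE (delta_mx 0 1); rewrite /= rowcomb_delta /=.
have : Phi (s *: delta_mx 0 0 - x *: delta_mx 0 1) = 0.
  apply: Phi0; rewrite linearB !linearZ /= !rowcomb_delta /=.
  by rewrite scalerN; apply/eqP; rewrite subr_eq0; apply/eqP; exact: mulrC.
rewrite linearB !linearZ /= ?scalerN -uE sann sub0r => /eqP;
  rewrite oppr_eq0 => /eqP/regW ->.
move=> /(submodN (multiples_submodule _ _)).
by rewrite sub0r opprK.
Qed.

(* After replacing p by a multiple, A : p is a prime with nonzero annihilator t,
   so p |-> t w defines a map on A + R p; it extends to the x-saturation of
   A + R p, and from there to P. *)
Lemma dualizing_separates W P (A : set P) p :
  dualizing x W -> fin_gen P -> projective_module P -> is_submodule A ->
  (forall q, A (x *: q) -> A q) -> ~ A p ->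
  exists2 psi : {linear P -> W}, (forall q, A q -> psi q = 0) & psi p <> 0.
Proof.
move=> dW fgP projP sA satA nAp; have [_ regW extW _ _] := dW.
have [r [nAr pr]] := colon_prime noethR sA nAp.
suff [psi psiA psir] : exists2 psi : {linear P -> W},
    (forall q, A q -> psi q = 0) & psi (r *: p) <> 0.
  by exists psi => // psip; apply: psir; rewrite linearZ /= psip scaler0.
move: (r *: p) nAr pr => {nAp}p nAp pp.
have nmp : ~ m `<=` colon A p by move=> /(_ _ mx)/satA.
have [t t0 tann] := nonmax_prime_ann noethR localR dimR pp nmp.
have [w tw] : exists w : W, t *: w <> 0.
  apply: contrapT => now; move/eqP: t0; apply;
    apply: (dualizing_faithful dW) => w.
  by apply: contrapT => tw; apply: now; exists w.
pose D := [set q | exists N, adjoin A p (x ^+ N *: q)].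
have sAp := adjoin_submodule p sA.
have Dmono q N k : adjoin A p (x ^+ N *: q) -> adjoin A p (x ^+ (k + N) *: q).
  by move=> Dq; rewrite exprD -scalerA; exact: (submodZ sAp).
have sD : is_submodule D.
  apply/is_submoduleP; split; first by exists 0%N; rewrite scaler0;
    exact: (submod0 sAp).
  move=> a u v [N uN] [K vK]; exists (N + K)%N.
  rewrite scalerDr scalerA mulrC -scalerA; apply: (submodZD sAp);
    last exact: Dmono.
  by rewrite addnC; exact: Dmono.
have noethP := fin_gen_noeth noethR fgP.
(* The saturation is finitely generated, so one exponent serves all of it. *)
have [N DN] : exists N, forall q, D q -> adjoin A p (x ^+ N *: q).
  have [|s sE] := noethP D sD; first by [].
  have [N sN] : exists N, {in s, forall q, adjoin A p (x ^+ N *: q)}.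
    have : {in s, forall q, D q} by move=> q sq; rewrite -sE; exact: span_sub.
    elim: (s) => [|q s' IHs] sD'; first by exists 0%N.
    have [K sK] := IHs (fun z zs => sD' z (mem_behead (s := q :: s') zs)).
    have [L qL] := sD' q (mem_head _ _).
    exists (K + L)%N => z; rewrite inE => /orP[/eqP->|/sK zK];
      first exact: Dmono.
    by rewrite addnC; exact: Dmono.
  have lin_x : linear (fun q : P => x ^+ N *: q).
    by move=> a u v; rewrite scalerDr !scalerA mulrC.
  exists N => q; rewrite -sE.
  exact: (span_seq_sub (is_submodule_preim (mk_linear lin_x) sAp)).
(* [f] extends x^N times the intended map, since r t w need not be divisible by x^N. The factor is
   harmless because x is regular on W. *)
have /choice[f fE] : forall q, exists y, forall a r, A a ->
    x ^+ N *: q = a + r *: p -> y = r *: (t *: w).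
  move=> q; have [[a0 [r0 [Aa0 qE]]]|nq] :=
    pselect (exists a r, A a /\ x ^+ N *: q = a + r *: p); last first.
    by exists 0 => a c Aa qE; case: nq; exists a, c.
  exists (r0 *: (t *: w)) => a c Aa; rewrite qE => ac.
  apply/subr0_eq; rewrite -scalerBl scalerA tann ?scale0r // /colon /=.
  have -> : (r0 - c) *: p = a - a0.
    rewrite scalerBl; apply/eqP; rewrite subr_eq addrAC eq_sym subr_eq.
    by rewrite -ac addrC.
  exact: submodB.
have [||psi psiE] := extW P D f fgP projP sD.
- by move=> q [K qK]; exists K.+1; rewrite exprSr -scalerA.
- move=> a u v /DN/adjoinP[n [c [An uE]]] /DN/adjoinP[k [b [Ak vE]]].
  rewrite (fE u _ _ An uE) (fE v _ _ Ak vE).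
  apply: (etrans (fE _ (a *: n + k) (a * c + b) _ _)).
  + exact: submodZD.
  + rewrite scalerDr scalerA mulrC -scalerA uE vE scalerDr scalerDl scalerA.
    by rewrite addrACA.
  + by rewrite scalerDl !scalerA.
have DA q : A q -> D q.
  by move=> Aq; exists 0%N; rewrite scale1r; exact: adjoin_sub.
exists psi => [q Aq|].
  rewrite psiE; last exact: DA.
  rewrite (fE q (x ^+ N *: q) 0) ?scale0r ?addr0 //.
  exact: submodZ.
rewrite psiE; last by exists 0%N; rewrite scale1r; exact: adjoin_mem.
rewrite (fE p 0 (x ^+ N)) ?add0r //; last exact: submod0.
elim: N {DN fE} => [|N IHN]; first by rewrite scale1r.
by rewrite exprS -scalerA => /regW.
Qed.

(** The map is first built on R v + x W, with generators v and x e_j: sending v to v' and x e_j to 0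
    is consistent modulo x, since r v in x W forces r in m, and [regular_lift] makes it exact. It
    sends x W into x W', so division by x extends it to W. *)
Lemma socle_hom W W' (v : W) (v' : W') :
  fin_gen W -> regular_on W x -> dualizing x W' ->
  socle_mod x v -> ~ multiples x v -> socle_mod x v' ->
  exists alpha : {linear W -> W'}, multiples x (alpha v - v').
Proof.
move=> fgW regW dW' sv nv sv'; have [_ regW' _ _ _] := dW'.
have [n [e eW]] := fin_genP fgW.
pose e1 (i : 'I_n.+1) : W := if unlift ord0 i is Some j then x *: e j else v.
have e1E r : rowcomb e1 r = r 0 ord0 *: v + x *: rowcomb e (\row_j r 0 (lift
  ord0 j)).
  rewrite /rowcomb big_ord_recl /e1 unlift_none scaler_sumr; congr (_ + _).
  by apply: eq_bigr => j _; rewrite liftK mxE !scalerA mulrC.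
have lin_v' : linear (fun r : 'rV[R]_n.+1 => r 0 ord0 *: v').
  by move=> a u w; rewrite !mxE scalerDl scalerA.
have [|Phi [PhiE Phi0]] := regular_lift (g := rowcomb e1) (phi :=
  mk_linear lin_v')
  dW' (@row_fin_gen _) (@row_projective _) regW.
  move=> r; rewrite /= e1E => /eqP; rewrite addr_eq0 => /eqP rv /=.
  apply: sv'; apply: (socle_coef sv nv); rewrite rv -scalerN.
  exact: multiplesZ.
pose D : set W := range (rowcomb e1).
have /choice[f fE] : forall p, exists y, forall r, rowcomb e1 r = p ->
  y = Phi r.
  move=> p; have [[r0 r0E]|nr] := pselect (exists r, rowcomb e1 r = p);
    last first.
    by exists 0 => r rE; case: nr; exists r.
  exists (Phi r0) => r rE; apply/subr0_eq; rewrite -linearB; apply: Phi0.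
  by rewrite linearB /= rE r0E subrr.
have fE' r : f (rowcomb e1 r) = Phi r by exact: fE.
have xD p : exists2 r, rowcomb e1 r = x *: p & r 0 ord0 = 0.
  have [c ->] := eW p.
  exists (\row_i if unlift ord0 i is Some j then c 0 j else 0); last first.
    by rewrite mxE unlift_none.
  rewrite e1E mxE unlift_none scale0r add0r; congr (_ *: rowcomb _ _).
  by apply/rowP => j; rewrite !mxE liftK.
have [||||| alpha [alphaD _]] := @baer_extend R W W' setT D f x fgW
  (is_submoduleT _) (is_submodule_image _ (is_submoduleT _)).
(* Since x phi(r) = r phi(x) = x r u and x is regular on W', the element u works on all of J. *)
- move=> J phi iJ Jx linphi _ [u _ uE]; exists u => // r Jr.
  apply: (regular_on_inj regW').
  rewrite -(@lin_onZ R R^o W' J phi iJ linphi) //.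
  have -> : x *: (r : R^o) = r *: (x : R^o) by rewrite /GRing.scale /= mulrC.
  by rewrite (@lin_onZ R R^o W' J phi iJ linphi) // uE !scalerA mulrC.
- by move=> p; have [r rE _] := xD p; exists r.
- by move=> a _ _ [r _ <-] [q _ <-]; rewrite -linearP !fE' linearP.
- by [].
- move=> p; have [r <- r0] := xD p; rewrite fE'.
  have := PhiE r; rewrite /= r0 scale0r subr0 => -[u _ uE].
  by exists u.
exists alpha.
have vE : rowcomb e1 (delta_mx 0 ord0) = v by rewrite rowcomb_delta /e1
  unlift_none.
rewrite alphaD; last by exists (delta_mx 0 ord0).
rewrite -vE fE'; have := PhiE (delta_mx 0 ord0).
by rewrite /= mxE !eqxx scale1r.
Qed.

(** The two maps given by [socle_hom] compose to a scalar r that fixes v' modulo x. As v' is a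
    nonzero socle class, r is a unit, so the composite is onto. *)
Lemma dualizing_surjection W W' : dualizing x W -> dualizing x W' ->
  exists alpha : {linear W -> W'}, range alpha = setT.
Proof.
move=> dW dW'.
have [fgW regW _ [v nv sv] _] := dW; have [fgW' regW' _ [v' nv' sv'] _] := dW'.
have [alpha alphaE] := socle_hom fgW regW dW' sv nv sv'.
have [beta betaE] := socle_hom fgW' regW' dW sv' nv' sv.
have [r rE] := endomorphism_scalar (alpha \o beta) dW'.
have sX := multiples_submodule W' x.
have [c rc] : exists c, r * c = 1.
  apply: (not_max_unit noethR localR) => mr; apply: nv'.
  have -> : v' = r *: v' - (alpha (beta v' - v) + (alpha v - v')).
    by rewrite linearB /= addrA subrK -[alpha (beta v')]/((alpha \o beta) v')
      rE subKr.
  apply: (submodB sX); first exact: sv'.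
  by apply: (submodD sX) => //; exact: multiples_linear.
exists alpha; apply/seteqP; split=> // u _.
exists (beta (c *: u)) => //.
by rewrite -[alpha _]/((alpha \o beta) (c *: u)) rE scalerA rc scale1r.
Qed.

End Duality.

(** * Syzygies of maximal Cohen-Macaulay modules *)

Section Syzygies.
Variables (R : comNzRingType) (noethR : noetherian R) (localR : local_ring R).
Hypothesis dimR : has_krull_dim R 1.
Local Notation m := (max_ideal R).
Variables (x : R) (mx : m x) (regx : regular_on R^o x).
Implicit Types M W P : lmodType R.

Lemma dual_basis P : fin_gen P -> projective_module P ->
  exists n (e : 'I_n -> P) (c : 'I_n -> {linear P -> R^o}),
    forall p, p = \sum_i (c i p : R) *: e i.
Proof.
move=> /fin_genP[n [e eP]] projP.
have idlin : linear (fun p : P => p) by [].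
have [|h hE] := projective_lift (f := mk_linear idlin) (g := rowcomb e) projP.
  by move=> p; have [r rE] := eP p; exists r.
by exists n, e, (fun i => row_coord R i \o h) => p; rewrite -[LHS]hE.
Qed.

(** Regularity of x on the cokernel becomes saturation of the image, the form in which the extension
    property of [dualizing] accepts it. *)
Lemma OmegaCM_embed M : OmegaCM M -> exists P (f : {linear M -> P}),
  [/\ fin_gen P, projective_module P, injective f &
      forall p, range f (x *: p) -> range f p].
Proof.
move=> [P [C [f [g [fgP projP mcmC [injf fg _]]]]]].
exists P, f; split=> // p; rewrite fg /lin_ker /= linearZ.
exact: (mcm_regular noethR localR dimR mcmC mx regx).
Qed.

Lemma OmegaCM_regular M a : OmegaCM M -> regular_on R^o a -> regular_on M a.
Proof.
move=> /OmegaCM_embed[P [f [fgP projP injf _]]] rega v av.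
have [n [e [c cE]]] := dual_basis fgP projP.
apply: injf; rewrite linear0 (cE (f v)) big1 // => i _.
suff -> : c i (f v) = 0 by rewrite scale0r.
by apply: rega; rewrite -!linearZ av !linear0.
Qed.

(** The map extends to P by vanishing of Ext^1, and a dual basis of P then factors it through a free
    module. *)
Lemma OmegaCM_hom_decomp M W (phi : {linear M -> W}) :
  dualizing x W -> OmegaCM M ->
  exists n (c : 'I_n -> {linear M -> R^o}) (w : 'I_n -> W),
    forall v, phi v = \sum_i (c i v : R) *: w i.
Proof.
move=> [_ _ extW _ _] /OmegaCM_embed[P [f [fgP projP injf satf]]].
have [n [e [c cE]]] := dual_basis fgP projP.
have /choice[phi' phi'E] : forall p, exists y, forall v, f v = p -> y = phi v.
  move=> p; have [[v <-]|np] := pselect (exists v, f v = p).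
    by exists (phi v) => u /injf ->.
  by exists 0 => v fv; case: np; exists v.
have [|||psi psiE] := extW P (range f) phi' fgP projP => //.
- exact: is_submodule_image (is_submoduleT _).
- move=> a _ _ [u _ <-] [v _ <-].
  by rewrite -linearP !(phi'E _ _ erefl) linearP.
exists n, (fun i => c i \o f), (fun i => psi (e i)) => v.
rewrite -(phi'E _ v erefl) -psiE; last by exists v.
by rewrite {1}(cE (f v)) linear_sum; apply: eq_bigr => i _; rewrite linearZ.
Qed.

Lemma OmegaCM_separated M W v : dualizing x W -> OmegaCM M ->
  (forall phi : LinHom M W, phi v = 0) -> v = 0.
Proof.
move=> dW /OmegaCM_embed[P [f [fgP projP injf _]]] vE.
have [n [e [c cE]]] := dual_basis fgP projP.
apply: injf; rewrite linear0 (cE (f v)) big1 // => i _.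
suff -> : c i (f v) = 0 by rewrite scale0r.
apply: (dualizing_faithful noethR localR dimR mx regx dW) => w.
have lin_w : linear (fun u => (c i (f u) : R) *: w).
  by move=> a p q; rewrite !linearP scalerDl scalerA.
exact: (vE (mk_linear lin_w)).
Qed.

(** Applied to the maps c_i(f -) w, Psi is an endomorphism of W in the variable w, hence a scalar
    r_i. As every map M -> W extends to P, Psi is evaluation at p = sum r_i e_i. *)
Lemma OmegaCM_reflexive M W (Psi : {linear LinHom M W -> W}) :
  dualizing x W -> OmegaCM M ->
  exists v, forall phi : LinHom M W, Psi phi = phi v.
Proof.
move=> dW OM; have [_ _ extW _ _] := dW.
have [P [f [fgP projP injf satf]]] := OmegaCM_embed OM.
have [n [e [c cE]]] := dual_basis fgP projP.
have linc i (w : W) : linear (fun v => (c i (f v) : R) *: w).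
  by move=> a p q; rewrite !linearP scalerDl scalerA.
pose cw i (w : W) : LinHom M W := mk_linear (linc i w).
have lincw i : linear (fun w => Psi (cw i w)).
  move=> a u w; rewrite -linearP; congr (Psi _); apply: LinHom_eq => v.
  by rewrite LinHom_addE LinHom_scaleE /= scalerDr !scalerA mulrC.
have /choice[r rE] : forall i, exists r, forall w, Psi (cw i w) = r *: w.
  move=> i.
  exact: (endomorphism_scalar noethR localR dimR mx regx (mk_linear (lincw i))
    dW).
pose p := \sum_i r i *: e i.
have PsiE (psi : {linear P -> W}) (phi : LinHom M W) :
    (forall v, phi v = psi (f v)) -> Psi phi = psi p.
  move=> phiE; have -> : phi = \sum_i cw i (psi (e i)).
    apply: LinHom_eq => v; rewrite phiE {1}(cE (f v)) linear_sum.
    rewrite -[RHS]/(eval_hom W v (\sum_i cw i (psi (e i)))) linear_sum.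
    by apply: eq_bigr => i _; rewrite linearZ.
  rewrite !linear_sum; apply: eq_bigr => i _.
  by rewrite rE linearZ.
have sf : is_submodule (range f) by exact: is_submodule_image (is_submoduleT _).
(* Otherwise a map P -> W vanishing on M would not vanish at p, whereas Psi sends its restriction 0
   to 0. *)
have [v _ vE] : range f p.
  apply: contrapT => nfp.
  have [psi psif] := dualizing_separates noethR localR dimR mx regx dW fgP projP
    sf satf nfp.
  apply; rewrite -(PsiE psi 0) ?linear0 // => v.
  by rewrite psif //; exists v.
exists v => phi.
have /choice[phi' phi'E] : forall p, exists y, forall v, f v = p -> y = phi v.
  move=> q; have [[u <-]|np] := pselect (exists u, f u = q).
    by exists (phi u) => u' /injf ->.
  by exists 0 => u fu; case: np; exists u.
have [|psi psiE] := extW P (range f) phi' fgP projP sf satf.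
  move=> a _ _ [u _ <-] [u' _ <-].
  by rewrite -linearP !(phi'E _ _ erefl) linearP.
have psif u : phi u = psi (f u).
  by rewrite psiE; [rewrite (phi'E _ u erefl)|exists u].
by rewrite (PsiE psi) // -vE psif.
Qed.

Definition hom_trace W M : set M :=
  submod_span [set v | exists (g : {linear W -> M}) (w : W), v = g w].

Lemma hom_trace_submodule W M : is_submodule (@hom_trace W M).
Proof. exact: span_submodule. Qed.

Lemma mem_hom_trace W M (g : {linear W -> M}) w : hom_trace W (g w).
Proof. by apply: span_sub; exists g, w. Qed.

Lemma trace_idealE M (f : {linear M -> R^o}) v : trace_ideal M (f v).
Proof. by apply: (span_sub (V := R^o)); exists f, v. Qed.

Lemma trace_ideal_submodule M : is_submodule (trace_ideal M : set R^o).
Proof. exact: span_submodule. Qed.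

Lemma trace_ideal_sub W M :
  @hom_trace W M = setT -> trace_ideal M `<=` trace_ideal W.
Proof.
move=> genM; have sW := trace_ideal_submodule W.
apply: (span_min (V := R^o) sW) => _ [f [v ->]].
have : hom_trace W v by rewrite genM.
apply: (span_min (is_submodule_preim f sW)) => _ [g [w ->]].
exact: (trace_idealE (f \o g)).
Qed.

Lemma trace_surjection W W' (alpha : {linear W -> W'}) : range alpha = setT ->
  trace_ideal W' `<=` trace_ideal W.
Proof.
move=> alphaT; apply: trace_ideal_sub; apply/seteqP; split=> // w' _.
have [w _ <-] : range alpha w' by rewrite alphaT.
exact: mem_hom_trace.
Qed.

Lemma hom_trace_surjection W W' M (alpha : {linear W -> W'}) :
  range alpha = setT -> @hom_trace W' M `<=` @hom_trace W M.
Proof.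
move=> alphaT; apply: span_min; first exact: hom_trace_submodule.
move=> _ [g [w' ->]]; have [w _ <-] : range alpha w' by rewrite alphaT.
exact: (mem_hom_trace (g \o alpha)).
Qed.

(** Evaluation at v is a sum of c_i(-) w_i with c_i : DM -> R. Each c_i yields W -> DDM = M, u |->
    c_i(-) u, and v is the sum of the images of the w_i. *)
Lemma dual_OmegaCM_hom_trace M W : dualizing x W -> OmegaCM M ->
  OmegaCM (LinHom M W) -> @hom_trace W M = setT.
Proof.
move=> dW OM OD; apply/seteqP; split=> // v _.
have [n [c [w cE]]] := OmegaCM_hom_decomp (eval_hom W v) dW OD.
have linc i (u : W) : linear (fun phi : LinHom M W => (c i phi : R) *: u).
  by move=> a phi psi; rewrite !linearP scalerDl scalerA.
have /choice[g gE] : forall i, exists g : {linear W -> M},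
    forall u (phi : LinHom M W), phi (g u) = (c i phi : R) *: u.
  move=> i.
  have /choice[g gE] : forall u, exists y, forall phi : LinHom M W,
      (c i phi : R) *: u = phi y.
    by move=> u; exact: (OmegaCM_reflexive (mk_linear (linc i u)) dW OM).
  have lin_g : linear g.
    move=> a u u'; apply/subr0_eq; apply: (OmegaCM_separated dW OM) => phi.
    rewrite linearB linearP /= -!gE scalerDr !scalerA mulrC.
    exact: subrr.
  by exists (mk_linear lin_g) => u phi; rewrite [RHS]gE.
have -> : v = \sum_i g i (w i).
  apply/subr0_eq; apply: (OmegaCM_separated dW OM) => phi.
  have gwE : phi (\sum_i g i (w i)) = \sum_i (c i phi : R) *: w i.
    by rewrite linear_sum; apply: eq_bigr => i _; exact: gE.
  by rewrite linearB /= gwE -[phi v]/(eval_hom W v phi) cE subrr.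
by apply: (submod_sum (@hom_trace_submodule W M)) => i _; exact: mem_hom_trace.
Qed.

(** Among the submodules generated by images of finitely many maps, a maximal one contains the image
    of any further map. *)
Lemma hom_trace_fin W M : noeth_module M -> @hom_trace W M = setT ->
  exists n (g : 'I_n -> {linear W -> M}), forall v, exists w,
    v = \sum_i g i (w i).
Proof.
move=> noethM genM.
pose S (gs : seq (LinHom W M)) :=
  submod_span [set v | exists2 g : LinHom W M, g \in gs & exists w, v = g w].
have [||_ [gs ->] maxS] := noeth_maximal (F := [set A | exists gs,
  A = S gs]) noethM.
- by move=> _ [gs ->]; exact: span_submodule.
- by exists (S [::]), [::].
have combS : S gs `<=` [set v | exists w : 'I_(size gs) -> W,
    v = \sum_(i < size gs) (nth (0 : LinHom W M) gs i : LinHom W M) (w i)].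
  apply: span_min.
    apply/is_submoduleP; split.
      by exists (fun=> 0); rewrite big1 // => i _; rewrite linear0.
    move=> a _ _ [w ->] [w' ->]; exists (fun i => a *: w i + w' i).
    by rewrite scaler_sumr -big_split; apply: eq_bigr => i _; rewrite linearP.
  move=> _ [g ggs [w ->]].
  have igs : (index g gs < size gs)%N by rewrite index_mem.
  exists (fun i => if i == Ordinal igs then w else 0).
  rewrite (bigD1 (Ordinal igs)) //= eqxx nth_index // big1 ?addr0 // =>
    i /negbTE ->.
  by rewrite linear0.
exists (size gs), (fun i => nth 0 gs i) => v.
apply: combS.
have : hom_trace W v by rewrite genM.
apply: (span_min (span_submodule _)) => _ [g [w ->]].
apply: (maxS (S ((g : LinHom W M) :: gs))); first by exists (g :: gs).
  apply: (span_min (span_submodule _)) => _ [g' g'gs [w' ->]].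
  by apply: span_sub; exists g'; [rewrite inE g'gs orbT|exists w'].
by apply: span_sub; exists g; [exact: mem_head|exists w].
Qed.

(** Dualizing W^n -> M, with kernel K, gives 0 -> DM -> R^n -> DK because End(W) = R. The image of
    R^n in DK is maximal Cohen-Macaulay, as x is regular on W. *)
Lemma hom_trace_dual_OmegaCM M W : dualizing x W -> noeth_module M ->
  @hom_trace W M = setT -> OmegaCM (LinHom M W).
Proof.
move=> dW noethM genM; have [_ regW _ _ _] := dW.
have [n [g gE]] := hom_trace_fin noethM genM.
have faithW := dualizing_faithful noethR localR dimR mx regx dW.
have /choice[rho rhoE] : forall phi : LinHom M W, exists r : 'rV[R]_n,
    forall i w, phi (g i w) = r 0 i *: w.
  move=> phi; have /choice[r rE] : forall i, exists r, forall w,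
    phi (g i w) = r *: w.
    move=> i.
    exact: (endomorphism_scalar noethR localR dimR mx regx (phi \o g i) dW).
  by exists (\row_i r i) => i w; rewrite mxE.
have rho_uniq (phi : LinHom M W) (r : 'rV[R]_n) : (forall i (w : W),
  phi (g i w) = r 0 i *: w) -> rho phi = r.
  move=> rE; apply/rowP => i; apply/subr0_eq; apply: faithW => w.
  by rewrite scalerBl -rhoE -rE subrr.
have lin_rho : linear rho.
  move=> a phi psi; apply: rho_uniq => i w.
  by rewrite !mxE LinHom_addE LinHom_scaleE !rhoE scalerDl scalerA.
(* [K] stays a bare type: the cokernel is realised among all functions K -> W, where regularity of x
   is pointwise. *)
pose K := {z : 'I_n -> W | \sum_i g i (z i) = 0}.
have lin_G : linear (fun (r : 'rV[R]_n) (z : K) => \sum_i r 0 i *: sval z i).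
  move=> a r q; apply/funext => z.
  rewrite -[RHS]/(a *: (\sum_i r 0 i *: sval z i) + \sum_i q 0 i *: sval z i).
  rewrite scaler_sumr -big_split; apply: eq_bigr => i _ /=.
  by rewrite !mxE scalerDl scalerA.
pose G := mk_linear lin_G.
pose sG := is_submodule_image G (is_submoduleT _).
have [|G' G'E] := corestrict (f := G) (S := submod_of sG).
  by move=> r; apply/in_submod_of; exists r.
have G'T : range G' = setT.
  apply/seteqP; split=> // y _.
  have /in_submod_of[r _ ry] := submodule_valP y.
  by exists r => //; apply: submodule_val_inj; rewrite G'E.
have G'0 r : G' r = 0 <-> forall z : K, \sum_i r 0 i *: sval z i = 0.
  split=> [r0 z|r0].
    by rewrite -[LHS]/(G r z) -G'E r0.
  by apply: submodule_val_inj; rewrite G'E; apply/funext => z; exact: r0.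
exists 'rV[R]_n, (submodule_type (submod_of sG)), (mk_linear lin_rho), G'.
split; [exact: row_fin_gen|exact: row_projective| |split=> //].
- apply: (regular_mcm noethR localR dimR _ mx regx).
    apply: noeth_fin_gen; apply: (noeth_image _ G'T); exact: noeth_row.
  move=> y xy; apply: submodule_val_inj; apply/funext => z; apply: regW.
  by have := congr1 (fun y' => submodule_val y' z) xy.
- move=> phi psi /= eq_rho; apply: LinHom_eq => v; have [w ->] := gE v.
  rewrite !linear_sum; apply: eq_bigr => i _.
  by rewrite !rhoE eq_rho.
apply/seteqP; split=> [_ [phi _ <-]|r /G'0 r0].
  apply/G'0 => -[z zE] /=.
  rewrite (eq_bigr (fun i => phi (g i (z i)))); last by move=> i _;
    rewrite rhoE.
  by rewrite -linear_sum zE linear0.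
have /choice[phi phiE] : forall v, exists y, forall w,
    v = \sum_i g i (w i) -> y = \sum_i r 0 i *: w i.
  move=> v; have [w vE] := gE v; exists (\sum_i r 0 i *: w i) => w' vE'.
  have zE : \sum_i g i (w i - w' i) = 0.
    rewrite (eq_bigr (fun i => g i (w i) - g i (w' i))); last first.
      by move=> i _; rewrite linearB.
    by rewrite sumrB -vE -vE' subrr.
  have := r0 (exist _ _ zE) => /=.
  rewrite (eq_bigr (fun i => r 0 i *: w i - r 0 i *: w' i)); last first.
    by move=> i _; rewrite scalerBr.
  by rewrite sumrB => /subr0_eq.
have lin_phi : linear phi.
  move=> a u v; have [w uE] := gE u; have [w' vE] := gE v.
  rewrite (phiE u w uE) (phiE v w' vE) (phiE _ (fun i => a *: w i + w' i)).
    rewrite scaler_sumr -big_split; apply: eq_bigr => i _ /=.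
    by rewrite scalerDr !scalerA mulrC.
  rewrite {1}uE {1}vE scaler_sumr -big_split; apply: eq_bigr => i _.
  by rewrite linearP.
exists (mk_linear lin_phi : LinHom M W) => //; apply: rho_uniq => i w /=.
rewrite (phiE _ (fun j => if j == i then w else 0)).
  rewrite (bigD1 i) //= eqxx big1 ?addr0 // => j /negbTE ->.
  by rewrite scaler0.
rewrite (bigD1 i) //= eqxx big1 ?addr0 // => j /negbTE ->.
by rewrite linear0.
Qed.

End Syzygies.

(** * Canonical reductions *)

Section Determinant.
Variables (R : comNzRingType) (J : set R) (b : R).
Hypotheses (iJ : is_ideal J)
  (JJ : forall j k, J j -> J k -> exists2 l, J l & j * k = b * l).

(** A product of two elements of [J] gains a factor [b], so every term of the expansion with some
    factor in [J] is [b ^+ n] times an element of [J]. *)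
Lemma prod_shift n (d c : 'I_n.+1 -> R) : (forall i, J (c i)) ->
  exists2 j, J j &
    \prod_i (b * d i + c i) = b ^+ n.+1 * \prod_i d i + b ^+ n * j.
Proof.
elim: n d c => [|n IHn] d c cJ.
  by exists (c ord0) => //; rewrite !big_ord_recl !big_ord0 !mulr1 mul1r.
have [j Jj jE] := IHn (fun i => d (widen_ord (leqnSn _) i))
  (fun i => c (widen_ord (leqnSn _) i)) (fun i => cJ _).
have [l Jl lE] := JJ Jj (cJ ord_max).
rewrite big_ord_recr /= jE [\prod_(i < n.+2) d i]big_ord_recr /=.
set D := \prod_(i < n.+1) _.
exists (D * c ord_max + (d ord_max * j + l)).
  apply: (idlD iJ); first exact: idlM.
  by apply: (idlD iJ) => //; exact: idlM.
have -> : (b ^+ n.+1 * D + b ^+ n * j) * (b * d ord_max + c ord_max) =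
    b ^+ n.+2 * (D * d ord_max) + b ^+ n.+1 * (D * c ord_max) +
    b ^+ n.+1 * (d ord_max * j) + b ^+ n * (j * c ord_max).
  by rewrite !exprS; ring.
by rewrite lE !exprS; ring.
Qed.

(** Formally det(1 - C / b) lies in 1 + J / b, since J / b is closed under products. It is proved
    permutation by permutation, with the entries of the identity matrix as [d] in [prod_shift]. *)
Lemma det_shift n (C : 'M[R]_n.+1) : (forall i k, J (C i k)) ->
  exists2 j, J j & \det (b%:M - C) = b ^+ n.+1 + b ^+ n * j.
Proof.
move=> CJ.
have /choice[j jE] : forall s : 'S_n.+1, exists j, J j /\
    \prod_i (b%:M - C) i (s i) =
    b ^+ n.+1 * \prod_i (1%:M : 'M[R]_n.+1) i (s i) + b ^+ n * j.
  move=> s.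
  have [|j Jj jE] := prod_shift (fun i => (1%:M : 'M[R]_n.+1) i (s i))
    (c := fun i => - C i (s i)).
    by move=> i; rewrite -mulN1r; exact: idlM.
  exists j; split=> //; rewrite -jE; apply: eq_bigr => i _.
  by rewrite !mxE; case: eqP; rewrite ?mulr1 ?mulr0.
exists (\sum_(s : 'S_n.+1) (-1) ^+ s * j s).
  apply: (submod_sum (V := R^o) iJ) => s _; apply: (idlM _ iJ).
  by case: (jE s).
have det1E : \det (1%:M : 'M[R]_n.+1) =
  \sum_(s : 'S_n.+1) (-1) ^+ s * \prod_i (1%:M : 'M[R]_n.+1) i (s i) by [].
have -> : b ^+ n.+1 = b ^+ n.+1 * \det (1%:M : 'M[R]_n.+1) by rewrite det1
  mulr1.
rewrite det1E !mulr_sumr -big_split /=.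
apply: eq_bigr => s _; have [_ ->] := jE s.
by rewrite mulrDr !(mulrCA _ ((-1) ^+ s)).
Qed.

End Determinant.

(** * The ring B = w^2 / a^2 and its action on M *)

Section CanonicalReduction.
Variables (R : comNzRingType) (noethR : noetherian R) (localR : local_ring R).
Hypothesis dimR : has_krull_dim R 1.
Local Notation m := (max_ideal R).
Variables (x : R) (mx : m x) (regx : regular_on R^o x).
Variables (w : submodClosed R^o).
Local Notation W := (submodule_type w).
Local Notation om := [set` w].
Hypothesis dW : dualizing x W.
Variable a : R.
Hypothesis red : ideal_pow om 3 = ideal_scale a (ideal_pow om 2).
Local Notation J := (ideal_pow om 2).

Let iom : is_ideal om. Proof. exact: submodClosed_submodule. Qed.

Let valW (u : W) : om (submodule_val u). Proof. exact: submodule_valP. Qed.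

Let toW r : om r -> exists u : W, submodule_val u = r.
Proof. by move=> wr; exists (SubmoduleType wr). Qed.

Let faithW r : (forall z, om z -> r * z = 0) -> r = 0.
Proof.
move=> rz; apply: (dualizing_faithful noethR localR dimR mx regx dW) => u.
by apply: submodule_val_inj; exact: rz (valW u).
Qed.

Let om1_sub : ideal_pow om 1 `<=` om.
Proof.
by apply: (span_min (V := R^o) iom) => _ [u wu [v _ <-]]; exact: idlMr.
Qed.

Let iJ : is_ideal J. Proof. exact: (span_submodule (V := R^o)). Qed.

Let J_mul u v : om u -> om v -> J (u * v).
Proof.
move=> wu wv; apply: (span_sub (V := R^o)); exists u => //; exists v => //.
apply: (span_sub (V := R^o)); exists v => //; exists 1 => //.
by rewrite mulr1.
Qed.

Let J_ind (B : set R) : is_ideal B -> (forall u v, om u -> om v -> B (u * v)) ->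
  J `<=` B.
Proof.
move=> iB Bmul; apply: (span_min (V := R^o) iB) => _ [u wu [v v1 <-]].
by apply: Bmul => //; exact: om1_sub.
Qed.

Let J_om : J `<=` om.
Proof. by apply: J_ind => // u v wu wv; exact: idlM. Qed.

Let J_red u y : om u -> J y -> exists2 y', J y' & u * y = a * y'.
Proof.
move=> wu Jy; have : ideal_pow om 3 (u * y).
  by apply: (span_sub (V := R^o)); exists u => //; exists y.
by rewrite red => -[y' Jy' <-]; exists y'.
Qed.

Let J_ext y (B : set R) : is_ideal B -> (forall u y', om u -> J y' ->
  B (u * y')) ->
  J y -> B (a * y).
Proof.
move=> iB Bmul Jy; have : ideal_pow om 3 (a * y) by rewrite red; exists y.
by apply: (span_min (V := R^o) iB) => _ [u wu [y' Jy' <-]]; exact: Bmul.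
Qed.

(** If a t = 0, then t kills a w^2 = w^3; faithfulness of w is used once per factor. *)
Lemma reduction_regular : regular_on R^o a.
Proof.
move=> t at0; apply: faithW => u wu; apply: faithW => v wv;
  apply: faithW => z wz.
have [y Jy yE] := J_red wu (J_mul wv wz).
have -> : t * u * v * z = t * (u * (v * z)) by rewrite !mulrA.
by rewrite yE mulrA [t * a]mulrC (at0 : a * t = 0) mul0r.
Qed.

Let rega := reduction_regular.

Let regaM (M : lmodType R) : OmegaCM M -> regular_on M a.
Proof.
by move=> OM; exact: (OmegaCM_regular noethR localR dimR mx regx OM rega).
Qed.

Let scaleWE c (u : W) : submodule_val (c *: u) = c * submodule_val u.
Proof. by []. Qed.

Let commW (f : {linear W -> R^o}) u v :
  submodule_val u * f v = submodule_val v * f u.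
Proof.
have -> : submodule_val u * f v = f ((submodule_val u : R) *: v) by rewrite
  linearZ.
have -> : submodule_val v * f u = f ((submodule_val v : R) *: u) by rewrite
  linearZ.
by congr (f _); apply: submodule_val_inj; rewrite !scaleWE mulrC.
Qed.

Let J_functional (f : {linear W -> R^o}) (B : set R) (y : W) : is_ideal B ->
  (forall u v : W, B (submodule_val u * f v)) -> J (submodule_val y) -> B (f y).
Proof.
move=> iB Bmul Jy.
have [y' [yy' By']] : exists y' : W,
  submodule_val y' = submodule_val y /\ B (f y').
  move: (submodule_val y) Jy => {}y.
  apply: (J_ind (B := [set y | exists y', submodule_val y' = y /\ B (f y')])).
    apply/is_idealP; split.
      by exists 0; rewrite linear0; split=> //; exact: idl0.
    move=> c _ _ [p [<- Bp]] [q [<- Bq]]; exists (c *: p + q); split=> //.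
    by rewrite linearP; apply: (idlD iB) => //; exact: idlM.
  move=> _ _ /toW[u <-] /toW[v <-]; exists ((submodule_val u : R) *: v).
  by split=> //; rewrite linearZ; exact: Bmul.
by rewrite -(submodule_val_inj yy').
Qed.

(* In terms of K = w / a, whose square is a ring, a functional f on w is
   multiplication by some q, and this says that q w^2 is contained in a R. *)
Lemma functional_divisible (f : {linear W -> R^o}) (u v : W) :
  principal a (submodule_val u * f v).
Proof.
have om_f y : J (submodule_val y) -> om (f y).
  by apply: (J_functional iom) => p q; exact: idlMr.
(* With f as multiplication by q, [th] is multiplication by q u v / a. It preserves w because u v w
   lies in a w^2 and q w^2 in w. Being an endomorphism of w, it is a scalar r, and a r = u f(v). *)
have /choice[th thE] : forall z : W, exists t : W,
    a * submodule_val t = submodule_val u * submodule_val v * f z.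
  move=> z; have [y Jy yE] := J_red (valW u) (J_mul (valW v) (valW z)).
  have [y' y'E] := toW (J_om Jy).
  have [t tE] : exists t : W, submodule_val t = f y'.
    by apply: toW; apply: om_f; rewrite y'E.
  exists t; rewrite tE.
  have -> : a * f y' = f (a *: y') by rewrite linearZ.
  have -> : a *: y' = (submodule_val u * submodule_val v : R) *: z.
    by apply: submodule_val_inj; rewrite !scaleWE y'E -yE mulrA.
  by rewrite linearZ.
have lin_th : linear th.
  have key (c p fp fq t t1 t2 : R) : a * t1 = p * fp -> a * t2 = p * fq ->
      a * t = p * (c * fp + fq) -> a * t = a * (c * t1 + t2).
    by move=> t1E t2E ->; rewrite mulrDr mulrCA -t1E -t2E mulrDr mulrCA.
  move=> c y z; apply: submodule_val_inj; apply: (regular_on_inj rega).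
  apply: (key _ _ _ _ _ _ _ (thE y) (thE z)).
  by have := thE (c *: y + z); rewrite linearP.
have [r rE] := endomorphism_scalar noethR localR dimR mx regx (mk_linear
  lin_th) dW.
exists r => //; apply/subr0_eq; apply: faithW => _ /toW[z <-].
rewrite mulrBl; apply/eqP; rewrite subr_eq0; apply/eqP.
have := thE z; rewrite -[th z]/(mk_linear lin_th z) rE scaleWE mulrA => ->.
by rewrite -mulrA commW mulrA mulrAC.
Qed.

(** This is tr(w) B <= R: y z equals a y' with y' in w^2, and f y' is divisible by a once more. *)
Lemma trace_divisible q y : trace_ideal W q -> J y ->
  principal (a ^+ 2) (y * q).
Proof.
move=> tq; move: q tq y.
have ia2 := principal_ideal (a ^+ 2).
apply: (span_min (V := R^o) (B := [set q | forall y, J y ->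
  principal (a ^+ 2) (y * q)])).
  apply/is_idealP; split=> [y _|c p q pE qE y Jy].
    by rewrite mulr0; exact: idl0.
  by rewrite mulrDr mulrCA; apply: (idlD ia2); [apply: (idlM _ ia2);
    exact: pE|exact: qE].
move=> _ [f [z ->]] y Jy.
have [y' Jy' yE] := J_red (valW z) Jy.
have [y1 y1E] := toW (J_om Jy').
have [r _ rE] : principal a (f y1).
  apply: (J_functional (principal_ideal a)); last by rewrite y1E.
  exact: functional_divisible.
exists r => //; rewrite expr2 -mulrA rE.
have -> : a * f y1 = f (a *: y1) by rewrite linearZ.
have -> : a *: y1 = y *: z.
  by apply: submodule_val_inj; rewrite !scaleWE y1E -yE mulrC.
by rewrite linearZ.
Qed.

(** This is B M <= M. Each phi v is a sum of elements of w with coefficients in tr(M), so (y / a^2)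
    phi v stays in w by [trace_divisible]. As a function of phi it is an element of DDM, hence
    evaluation at some v'. *)
Lemma module_divisible (M : lmodType R) y (v : M) : OmegaCM M ->
  trace_ideal M `<=` trace_ideal W -> J y -> exists v', a ^+ 2 *: v' = y *: v.
Proof.
move=> OM tMW Jy.
have rega2 (V : lmodType R) : regular_on V a -> injective (fun u : V =>
  a ^+ 2 *: u).
  move=> regV; apply: regular_on_inj => u.
  by rewrite expr2 -scalerA => /regV/regV.
have regW : regular_on W a.
  by move=> u au; apply: submodule_val_inj; apply: rega; have := congr1 val au.
have /choice[Psi PsiE] : forall phi : LinHom M W, exists z : W,
    a ^+ 2 *: z = y *: phi v.
  move=> phi.
  have [n [c [u cE]]] := OmegaCM_hom_decomp noethR localR dimR mx regx phi dW
    OM.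
  have /choice[r rE] : forall i, exists r, a ^+ 2 * r = y * c i v.
    move=> i; have [|r _ rE] := @trace_divisible (c i v) y _ Jy.
      by apply: tMW; exact: trace_idealE.
    by exists r.
  exists (\sum_i r i *: u i); rewrite cE !scaler_sumr; apply: eq_bigr => i _.
  by rewrite !scalerA rE.
have lin_Psi : linear Psi.
  move=> c phi psi; apply: (rega2 _ regW); rewrite /= scalerDr !PsiE.
  by rewrite LinHom_addE LinHom_scaleE scalerA mulrC -scalerA PsiE scalerDr
    !scalerA mulrC.
have [v' v'E] := OmegaCM_reflexive noethR localR dimR mx regx (mk_linear
  lin_Psi) dW OM.
exists v'; apply/subr0_eq.
apply: (OmegaCM_separated noethR localR dimR mx regx dW OM) => phi.
by rewrite linearB !linearZ /= ?scalerN -v'E PsiE subrr.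
Qed.

Let JJ j k : J j -> J k -> exists2 l, J l & j * k = a ^+ 2 * l.
Proof.
move=> Jj Jk; move: j Jj.
apply: (J_ind (B := [set j | exists2 l, J l & j * k = a ^+ 2 * l])).
  apply/is_idealP; split; first by exists 0; rewrite ?mul0r ?mulr0 //;
    exact: (idl0 iJ).
  move=> c p q [l Jl lE] [l' Jl' l'E]; exists (c * l + l').
    by apply: (idlD iJ) => //; exact: (idlM _ iJ).
  by rewrite mulrDl -mulrA lE l'E mulrDr mulrCA.
move=> u v wu wv.
have [y Jy yE] := J_red wv Jk; have [z Jz zE] := J_red wu Jy.
by exists z => //; rewrite -mulrA yE mulrCA zE expr2 mulrA.
Qed.

Let faithJ t : (forall j, J j -> t * j = 0) -> t = 0.
Proof.
move=> tJ; apply: faithW => u wu; apply: faithW => v wv.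
by rewrite -mulrA; apply: tJ; exact: J_mul.
Qed.

(* Since w^3 = a w^2, the square of J is a^2 J; the determinant trick then
   shows that the fractional ideal J / a^2 contains 1. *)
Lemma square_mem : J (a ^+ 2).
Proof.
have [s sJ] := noethR iJ.
have sJ' i : J (nth 0 s i).
  have [si|si] := ltnP i (size s); last by rewrite nth_default //;
    exact: (idl0 iJ).
  by rewrite -sJ; apply: (span_sub (V := R^o)); exact: mem_nth.
case: s sJ sJ' => [|s0 s] sJ sJ'.
  suff /eqP : 1 = 0 :> R by rewrite oner_eq0.
  by apply: faithJ => j; rewrite -sJ => /(submod_span_nil (V := R^o)) ->;
    rewrite mulr0.
set n := size s; pose e (i : 'I_n.+1) : R := nth 0 (s0 :: s) i.
(* [Q] is J J written with coefficients from [J] on the generators [e], the shape that yields a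
   matrix with entries in [J]. *)
pose Q := [set t | exists2 c : 'I_n.+1 -> R, (forall i, J (c i)) &
  t = \sum_i c i * e i].
have iQ : is_ideal Q.
  apply/is_idealP; split.
    exists (fun=> 0); first by move=> _; exact: (idl0 iJ).
    by rewrite big1 // => i _; rewrite mul0r.
  move=> c _ _ [p pJ ->] [q qJ ->]; exists (fun i => c * p i + q i).
    by move=> i; apply: (idlD iJ) => //; exact: (idlM _ iJ).
  rewrite mulr_sumr -big_split; apply: eq_bigr => i _ /=.
  by rewrite mulrDl mulrA.
have QJJ j k : J j -> J k -> Q (j * k).
  move=> Jj; rewrite -{1}sJ => /(span_seqP (V := R^o))[r ->].
  exists (fun i => j * r i); first by move=> i; exact: (idlMr _ iJ).
  by rewrite mulr_sumr; apply: eq_bigr => i _; rewrite -mulrA.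
have Qcolon t : is_ideal [set r | Q (t * r)].
  apply/is_idealP; split; first by rewrite /= mulr0; exact: (idl0 iQ).
  by move=> c p q Qp Qq /=; rewrite mulrDr mulrCA; apply: (idlD iQ) => //;
    exact: (idlM _ iQ).
(* Here w^3 = a w^2 is read backwards, twice: a^2 w^2 lies in w w w^2. *)
have a2Q y : J y -> Q (a ^+ 2 * y).
  move=> Jy; rewrite expr2 -mulrA.
  apply: (J_ext (y := y) (Qcolon a)) => // u y1 wu Jy1 /=.
  rewrite mulrCA; apply: (J_ext (y := y1) (Qcolon u)) => // v y2 wv Jy2 /=.
  by rewrite mulrA; apply: QJJ => //; exact: J_mul.
have /choice[c cE] : forall i, exists c : 'I_n.+1 -> R,
    (forall k, J (c k)) /\ a ^+ 2 * e i = \sum_k c k * e k.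
  by move=> i; have [c cJ cE] := a2Q _ (sJ' i); exists c.
pose C := \matrix_(i, k) c i k.
have Ce : ((a ^+ 2)%:M - C) *m (\col_k e k) = 0.
  apply/colP => i; rewrite mulmxBl mul_scalar_mx !mxE; have [_ ->] := cE i.
  by apply/eqP; rewrite subr_eq0; apply/eqP; apply: eq_bigr => k _;
    rewrite !mxE.
have det0 : \det ((a ^+ 2)%:M - C) = 0.
  apply: faithJ => j; rewrite -{1}sJ; set t := \det _.
  have it : is_ideal [set r | t * r = 0].
    apply/is_idealP; split; first by rewrite /= mulr0.
    by move=> r p q /= p0 q0; rewrite mulrDr mulrCA p0 q0 mulr0 addr0.
  apply: (span_seq_sub (V := R^o) it) => _ /(nthP 0)[i si <-] /=.
  have := congr1 (mulmx (\adj ((a ^+ 2)%:M - C))) Ce.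
  rewrite mulmxA mul_adj_mx mulmx0 mul_scalar_mx => /colP/(_ (Ordinal si)).
  by rewrite !mxE.
(* The vanishing determinant is (a^2)^n (a^2 + j); cancelling powers of the regular element a leaves
   a^2 = -j. *)
have [|j Jj] := @det_shift R J (a ^+ 2) iJ JJ n C.
  by move=> i k; rewrite mxE; have [] := cE i.
rewrite det0 exprSr -mulrDr => /esym.
have powreg k t : a ^+ k * t = 0 -> t = 0.
  elim: k => [|k IHk]; first by rewrite expr0 mul1r.
  by rewrite exprS -mulrA => /(rega (v := _ * _))/IHk.
rewrite -exprM => /powreg/eqP; rewrite addr_eq0 => /eqP ->.
by rewrite -mulN1r; exact: (idlM _ iJ).
Qed.

(** As B contains 1, it contains each u / a, so every v gives a map w -> M, u |-> (u / a) v. Two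
    such maps in succession realise (u u' / a^2) v, and sums of these reach v because a^2 lies in
    w^2. *)
Lemma hom_trace_eqT (M : lmodType R) : OmegaCM M ->
  trace_ideal M `<=` trace_ideal W -> @hom_trace R W M = setT.
Proof.
move=> OM tMW.
have regM := regaM OM.
have divM (u : W) (v : M) : exists v', a *: v' = (submodule_val u : R) *: v.
  have [y Jy yE] := J_red (valW u) square_mem.
  have {}yE : submodule_val u * a = y.
    apply: (regular_on_inj rega); rewrite -[a *: y]/(a * y) -yE.
    by rewrite /GRing.scale /= expr2; ring.
  have [v' v'E] := module_divisible v OM tMW Jy; exists v'.
  apply: (regular_on_inj regM); rewrite scalerA -expr2 v'E -yE.
  by rewrite scalerA mulrC.
have /choice[g gE] : forall v, exists g : {linear W -> M},
    forall u, a *: g u = (submodule_val u : R) *: v.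
  move=> v; have /choice[g gE] := fun u => divM u v.
  have lin_g : linear g.
    move=> c p q; apply: (regular_on_inj regM).
    by rewrite scalerDr scalerA mulrC -scalerA !gE scalerA -scalerDl.
  by exists (mk_linear lin_g).
have sG := @hom_trace_submodule R W M.
have JG : J `<=` [set y | forall v,
    exists2 t : M, hom_trace W t & a ^+ 2 *: t = y *: v].
  apply: J_ind.
    apply/is_idealP; split=> [v|c p q pG qG v].
      by exists 0; [exact: (submod0 sG)|rewrite scaler0 scale0r].
    have [t Gt tE] := pG v; have [t' Gt' t'E] := qG v.
    exists (c *: t + t'); first exact: (submodZD sG).
    by rewrite scalerDr scalerA mulrC -scalerA tE t'E scalerA -scalerDl.
  move=> _ _ /toW[u <-] /toW[u' <-] v.
  exists (g (g v u') u); first exact: mem_hom_trace.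
  by rewrite expr2 -scalerA gE scalerA mulrC -scalerA gE scalerA.
apply/seteqP; split=> // v _; have [t Gt] := JG _ square_mem v.
by rewrite expr2 -!scalerA => /(regular_on_inj regM)/(regular_on_inj regM) <-.
Qed.

End CanonicalReduction.

Lemma ideal_mul_scale (R : comNzRingType) (a : R) (I K : set R) :
  ideal_mul I (ideal_scale a K) = ideal_scale a (ideal_mul I K).
Proof.
have lin_a : linear (fun r : R^o => a * r : R^o).
  by move=> c p q; rewrite mulrDr mulrCA.
apply/seteqP; split.
  apply: (span_min (V := R^o)
    (is_submodule_image (mk_linear lin_a) (span_submodule _))).
  move=> _ [u Iu [_ [k Kk <-] <-]]; exists (u * k); last by rewrite /= mulrCA.
  by apply: (span_sub (V := R^o)); exists u => //; exists k.
suff H : ideal_mul I K `<=` mk_linear lin_a @^-1` ideal_mul I (ideal_scale a K).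
  by move=> _ [r Ir <-]; exact: H.
apply: (span_min (V := R^o)
  (is_submodule_preim (mk_linear lin_a) (span_submodule _))).
move=> _ [u Iu [k Kk <-]] /=; apply: (span_sub (V := R^o)).
by exists u => //; exists (a * k); [exists k|rewrite mulrCA].
Qed.

Lemma ideal_pow_red (R : comNzRingType) (a : R) (I : set R) n k :
  ideal_pow I n.+1 = ideal_scale a (ideal_pow I n) ->
  ideal_pow I (k + n).+1 = ideal_scale a (ideal_pow I (k + n)).
Proof.
move=> red; elim: k => [|k IHk] //.
rewrite -[LHS]/(ideal_mul I (ideal_pow I (k + n).+1)) IHk.
by rewrite ideal_mul_scale -IHk.
Qed.

Lemma can_red_le2 (R : comNzRingType) : le_extnat (can_red R) 2 ->
  exists (w : submodClosed R^o) (a : R), canonical_ideal w /\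
    ideal_pow [set` w] 3 = ideal_scale a (ideal_pow [set` w] 2).
Proof.
rewrite /can_red /nat_inf; case: pselect => // exA /=.
case: ex_minnP => n /set_mem[w [a [can_w _ red]]] _ n2.
exists w, a; split=> //.
by have := ideal_pow_red (2 - n) red; rewrite subnK.
Qed.

Lemma cohen_macaulay_regular (R : comNzRingType) : has_krull_dim R 1 ->
  cohen_macaulay R -> exists2 x : R, max_ideal R x & regular_on R^o x.
Proof.
move=> dimR [d [_ dmax] [[xs [xsm xsreg _] sxs] _]].
have d1 : (0 < size xs)%N by rewrite sxs; apply: dmax; case: dimR.
exists (nth 0 xs 0); first by apply: xsm; exact: mem_nth.
move=> v xv; apply: (@seq_mul_nil R R^o); rewrite -(take0 xs).
apply: xsreg => //; rewrite xv.
exact: (submod0 (@seq_mul_submodule R R^o _)).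
Qed.

Theorem theorem3p15 (R : comNzRingType)
    (noethR : noetherian R) (localR : local_ring R) (dimR : has_krull_dim R 1)
    (cmR : cohen_macaulay R) (ggR : generically_gorenstein R)
    (w : submodClosed R^o) (can_w : canonical_ideal w)
    (can_redR : le_extnat (can_red R) 2)
    (M : lmodType R) (MOmegaCM : OmegaCM M) :
  OmegaCM (LinHom M (submodule_type w)) <->
  trace_ideal M `<=` trace_ideal (submodule_type w).
Proof.
have [x mx regx] := cohen_macaulay_regular dimR cmR.
have dual (u : submodClosed R^o) : canonical_ideal u ->
  dualizing x (submodule_type u).
  move=> [W [canW isoW]]; apply: dualizing_iso isoW.
  exact: canonical_dualizing.
have dw := dual _ can_w.
have [w' [a [can_w' red]]] := can_red_le2 can_redR.
have dw' := dual _ can_w'.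
split=> [OD|trM].
  apply: trace_ideal_sub.
  exact: (dual_OmegaCM_hom_trace noethR localR dimR mx regx dw MOmegaCM OD).
(* The reduction belongs to [w'], which may differ from [w]: [beta] gives tr(w) <= tr(w'), and
   [alpha] turns images of w' in M into images of w. *)
have [alpha alphaT] := dualizing_surjection noethR localR dimR mx regx dw dw'.
have [beta betaT] := dualizing_surjection noethR localR dimR mx regx dw' dw.
have [P [f [fgP _ injf _]]] :=
  OmegaCM_embed noethR localR dimR mx regx MOmegaCM.
apply: (hom_trace_dual_OmegaCM noethR localR dimR mx regx dw).
  exact: (noeth_inj (fin_gen_noeth noethR fgP) injf).
apply/seteqP; split=> // v _; apply: (hom_trace_surjection alphaT).
rewrite (hom_trace_eqT noethR localR dimR mx regx dw' red MOmegaCM) //.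
exact: (subset_trans trM (trace_surjection betaT)).
Qed.
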